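(* When $h$ and $k$ are natural numbers with $h\ge 2$ and $k\ge 2$, one has $W(k,h)\le k^2+k-2$.
   Context: For positive integers $h,k$ with $h\ge 2$, $W(k,h)$ denotes the least natural number $s$ having the property that the simultaneous equations $$\sum_{i=1}^sx_{i1}^j=\sum_{i=1}^sx_{i2}^j=\ldots=\sum_{i=1}^sx_{ih}^j\quad(1\le j\le k)$$ possess an integral solution $\mathbf{x}=(x_{iu})_{1\le i\le s,\,1\le u\le h}$ with $\sum_{i=1}^sx_{iu}^{k+1}\ne\sum_{i=1}^sx_{iv}^{k+1}$ for all $1\le u<v\le h$. *)

(* Defs.v *)
From mathcomp Require Import all_boot all_order all_algebra.
Set Implicit Arguments.
Unset Strict Implicit.
Unset Printing Implicit Defensive.
Import Order.TTheory GRing.Theory Num.Theory.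
Local Open Scope ring_scope.

Definition power_sum (s h : nat) (x : 'M[int]_(s, h)) (j : nat) (u : 'I_h) : int :=
  \sum_(i < s) x i u ^+ j.

Definition solvable_with (k h s : nat) : Prop :=
  exists x : 'M[int]_(s, h),
    (forall j : nat, (1 <= j <= k)%N ->
       forall u v : 'I_h, power_sum x j u = power_sum x j v) /\
    (forall u v : 'I_h, (u < v)%N ->
       power_sum x k.+1 u <> power_sum x k.+1 v).

(* [is_W k h w] is the graph of the function W, i.e. W(k,h) = w.  There is no
   junk value: when no s is admissible, [is_W k h w] fails for every w. *)
Definition is_W (k h w : nat) : Prop :=
  solvable_with k h w /\ forall s : nat, solvable_with k h s -> (w <= s)%N.

(* Main.v *)
(* Write [K = k + 1] for the degree, [s = K^2 - K - 2 = k^2 + k - 2], and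
   [J_t(X)] for the number of solutions in [0, X) of Vinogradov's system
   [sum x_i^j = sum y_i^j] ([1 <= j <= K], [t] variables on each side).

   If [W(k,h) > s], then on [0, X)^s the first [k] power sums determine the
   [K]-th one up to fewer than [h] values, so by Cauchy-Schwarz
   [J_s(X) >> X^(2s - K(K-1)/2)].  On the other hand Hoelder's inequality
   bounds [J_s(X)^(K^2)] by [J_K(X)^(2K+2) J_w(X)^(K^2-2K-2)], [w = K(K+1)],
   where [J_K(X) << X^K] by Newton's identities, and Wooley's efficient
   congruencing gives [J_w(p^n) << (2 p^(3K(K+1)/2))^n] for every large prime
   [p].  The two bounds contradict each other because [p^K > 2^(K^2)].

   For the last estimate, let [n] be a record, i.e. suppose that [J_w(p^m)]
   decays at least by the factor [2 p^(3K(K+1)/2)] at each step down from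
   [m = n].  Mean values in which [K] variables are conditioned to distinct
   residue classes are compared at the scales [p^a], [p^(K a)], [p^(K^2 a)]
   and so on: each comparison gains a factor [2^a], and enough of them
   contradict the trivial bounds.  Hence large [n] are never records.  The
   prime [p] stays fixed, so every loss depending on [p] alone is harmless.

   Mean values are taken over the characters of a finite group [(Z/N)^K]. *)
Require Import Defs.
From mathcomp Require Import all_boot all_order all_algebra all_field.
From mathcomp Require Import zify ring lra.
From Stdlib Require Import Classical.
Set Implicit Arguments.
Unset Strict Implicit.
Unset Printing Implicit Defensive.
Import Order.TTheory GRing.Theory Num.Theory.
Local Open Scope ring_scope.

(** * Newton's identities *)

Section Newton.
Variables (R : comUnitRingType) (n k : nat).

(** The reversal of the monic polynomial with roots [x i]: its coefficients are the signed
    elementary symmetric functions, beginning with 1. *)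
Definition root_rev_poly (x : 'I_n -> R) : {poly R} :=
  \prod_(i < n) (1 - x i *: 'X).

Lemma coef0_root_rev_poly x : (root_rev_poly x)`_0 = 1.
Proof.
rewrite /root_rev_poly -horner_coef0 horner_prod big1 // => i _.
by rewrite hornerD hornerN hornerZ hornerX mulr0 subr0 hornerC.
Qed.

(* [- 'X P'] is, modulo ['X^(k+1)], the product of [P] with the generating
   series of the power sums. *)
Lemma newton_poly x : exists q : {poly R},
  (\sum_(1 <= j < k.+1) (\sum_(i < n) x i ^+ j) *: 'X^j) * root_rev_poly x
    + 'X * (root_rev_poly x)^`() = 'X^(k.+1) * q.
Proof.
pose P i := \prod_(j < n | j != i) (1 - x j *: 'X).
have PE i : root_rev_poly x = (1 - x i *: 'X) * P i.
  by rewrite /root_rev_poly (bigD1 i).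
(* For each [i] the truncated geometric series in [x i] times ['X] telescopes: its first term
   cancels against the derivative, its last one gives this [q]. *)
exists (- \sum_i (x i ^+ k.+1) *: P i).
have -> : (root_rev_poly x)^`() = - \sum_i x i *: P i.
  rewrite /root_rev_poly.
  suff H : forall r : seq 'I_n, uniq r ->
    (\prod_(i <- r) (1 - x i *: 'X))^`() =
    - \sum_(i <- r) x i *: \prod_(j <- r | j != i) (1 - x j *: 'X).
    by rewrite H // index_enum_uniq.
  elim=> [|a r IH] /=; first by rewrite !big_nil derivC oppr0.
  case/andP=> ar ur; rewrite !big_cons derivM IH // eqxx /=.
  rewrite derivB derivC sub0r derivZ derivX alg_polyC.
  rewrite opprD; congr (_ + _).
    rewrite mulNr mul_polyC; congr (- (_ *: _)).
    rewrite big_seq [RHS]big_seq_cond; apply: eq_bigl => i.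
    by case: (boolP (i \in r)) => //= ir; apply/esym/eqP => ia; rewrite -ia ir in ar.
  rewrite mulrN mulr_sumr; congr (- _); rewrite !big_seq; apply: eq_bigr => i ir.
  rewrite big_cons ifT; last by apply/eqP => ia; rewrite ia ir in ar.
  by rewrite scalerAr.
have -> : (\sum_(1 <= j < k.+1) (\sum_(i < n) x i ^+ j) *: 'X^j) =
   \sum_(i < n) \sum_(1 <= j < k.+1) (x i *: 'X) ^+ j.
  rewrite exchange_big /=; apply: eq_bigr => j _; rewrite scaler_suml.
  by apply: eq_bigr => i _; rewrite exprZn.
rewrite mulr_suml mulrN mulrN !mulr_sumr -sumrN -sumrN -big_split /=.
apply: eq_bigr => i _; rewrite (PE i) mulrA.
have -> : (\sum_(1 <= j < k.+1) (x i *: 'X) ^+ j) * (1 - x i *: 'X) =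
   x i *: 'X - (x i *: 'X) ^+ k.+1.
  elim: (k) => [|m IH]; first by rewrite big_geq // mul0r expr1 subrr.
  rewrite big_nat_recr //= mulrDl IH [(_ ^+ m.+2) in RHS]exprS; ring.
rewrite mulrBl exprZn; rewrite -!mul_polyC; ring.
Qed.

Hypothesis unit_k : forall m, (1 <= m <= k)%N -> m%:R \is a @GRing.unit R.

(** Comparing coefficients in [newton_poly] expresses [m] times the [m]-th coefficient by power sums
    and earlier coefficients; [unit_k] allows division by [m]. *)
Lemma newton_coef (x y : 'I_n -> R) :
  (forall j, (1 <= j <= k)%N -> \sum_(i < n) x i ^+ j = \sum_(i < n) y i ^+ j) ->
  forall m, (m <= k)%N -> (root_rev_poly x)`_m = (root_rev_poly y)`_m.
Proof.
move=> xy; have [q qE] := newton_poly x; have [r rE] := newton_poly y.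
elim/ltn_ind => -[|m] IH mk; first by rewrite !coef0_root_rev_poly.
set S := \sum_(1 <= j < k.+1) _ in qE.
have SE : S = \sum_(1 <= j < k.+1) (\sum_(i < n) y i ^+ j) *: 'X^j.
  rewrite /S !big_nat; apply: eq_bigr => j; rewrite ltnS => hj.
  by rewrite xy.
rewrite -SE in rE.
have S0 : S`_0 = 0.
  rewrite /S big_nat coef_sum big1 // => j /andP[j1 _].
  by rewrite coefZ coefXn eq_sym eqn0Ngt j1 mulr0.
have key (z : 'I_n -> R) t : S * root_rev_poly z + 'X * (root_rev_poly z)^`() = 'X^(k.+1) * t ->
   (root_rev_poly z)`_m.+1 *+ m.+1 = - \sum_(j < m.+1) S`_j.+1 * (root_rev_poly z)`_(m - j).
  move=> /(congr1 (fun p : {poly R} => p`_m.+1)).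
  rewrite [RHS]coefXnM ltnS mk coefD coefXM coefM /= coef_deriv big_ord_recl S0 mul0r add0r.
  by move/eqP; rewrite addrC addr_eq0 => /eqP->.
have /mulIr : m.+1%:R \is a @GRing.unit R by apply: unit_k.
apply; rewrite !mulr_natr (key _ _ qE) (key _ _ rE); congr (- _).
apply: eq_bigr => j _; rewrite IH //; first by rewrite ltnS leq_subr.
by apply: leq_trans (leq_subr _ _) _; apply: ltnW.
Qed.

End Newton.

(** The conclusion is about values of the monic polynomials because in a ring such as ['Z_(p ^ m)]
    equal polynomials may split into different linear factors. *)
Lemma power_sums_prod (R : comUnitRingType) (k : nat) (x y : 'I_k -> R) :
  (forall m, (1 <= m <= k)%N -> m%:R \is a @GRing.unit R) ->
  (forall j, (1 <= j <= k)%N -> \sum_(i < k) x i ^+ j = \sum_(i < k) y i ^+ j) ->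
  forall t, \prod_(i < k) (t - x i) = \prod_(i < k) (t - y i).
Proof.
move=> uk xy t.
have revE (z : 'I_k -> R) :
   \prod_(i < k) (t - z i) = \sum_(m < k.+1) (root_rev_poly z)`_m * t ^+ (k - m).
  (* The exponent [j] is kept free because removing the last variable uses the induction hypothesis
     at both [j] and [j.-1]. *)
  suff H n : forall (u : 'I_n -> R) (j : nat), (n <= j)%N ->
      t ^+ (j - n) * \prod_(i < n) (t - u i) =
      \sum_(m < j.+1) (root_rev_poly u)`_m * t ^+ (j - m).
    by have := H k z k (leqnn _); rewrite subnn mul1r.
  elim: n => [|n IH] u j nj.
    rewrite /root_rev_poly !big_ord0 mulr1 big_ord_recl coef1 mul1r subn0 /=.
    by rewrite big1 ?addr0 // => i _; rewrite coef1 mul0r.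
  set v := fun i : 'I_n => u (widen_ord (leqnSn n) i).
  have -> : root_rev_poly u = root_rev_poly v * (1 - u ord_max *: 'X).
    by rewrite /root_rev_poly big_ord_recr.
  rewrite big_ord_recr /= -/(v _).
  rewrite mulrA mulrBr.
  have IHj := IH v j (ltnW nj).
  have IHj' := IH v j.-1; rewrite -ltnS (ltn_predK nj) in IHj'.
  have {IHj'} IHj' := IHj' nj.
  rewrite -mulrA [_ * t]mulrC mulrA -exprSr -subSn // subSS IHj.
  have -> : (j - n.+1)%N = (j.-1 - n)%N by rewrite -subn1 -subnDA add1n.
  rewrite IHj'.
  under [RHS]eq_bigr => i _ do rewrite mulrBr mulr1 coefB mulrBl.
  rewrite sumrB; congr (_ - _).
  rewrite [RHS]big_ord_recl -scalerAr coefZ coefMX mulr0 mul0r add0r.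
  rewrite mulr_suml; apply: eq_bigr => i _.
  rewrite coefZ coefMX /=.
  have -> : (j - bump 0 i)%N = (j.-1 - i)%N by rewrite /bump /= -subn1 -subnDA.
  ring.
rewrite !revE; apply: eq_bigr => m _; congr (_ * _).
by apply: (newton_coef uk xy); rewrite -ltnS.
Qed.

(** * Inequalities for averages *)

Lemma algR_root (x : algR) m : 0 <= x -> (0 < m)%N ->
  exists2 y : algR, 0 <= y & y ^+ m = x.
Proof.
move=> x0 m0; have x0' : 0 <= algRval x by [].
have y0 : 0 <= m.-root (algRval x) by rewrite rootC_ge0.
exists (in_algR (ger0_real y0)) => //.
by apply: val_inj; rewrite rmorphXn /= rootCK.
Qed.

(** For an empty [T] the value is 0, since the inverse of 0 is 0. *)
Definition avg (T : finType) (F : T -> algR) : algR := (\sum_t F t) / #|T|%:R.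

Section Averages.
Variable T : finType.
Implicit Types F G : T -> algR.

Lemma avg_ge0 F : (forall t, 0 <= F t) -> 0 <= avg F.
Proof. by move=> F0; rewrite divr_ge0 ?ler0n // sumr_ge0. Qed.

Lemma avg_le F G : (forall t, F t <= G t) -> avg F <= avg G.
Proof. by move=> FG; rewrite ler_wpM2r ?invr_ge0 ?ler0n // ler_sum. Qed.

Lemma eq_avg F G : F =1 G -> avg F = avg G.
Proof. by move=> FG; rewrite /avg (eq_bigr G). Qed.

Lemma avgZ a F : avg (fun t => a * F t) = a * avg F.
Proof. by rewrite /avg -mulr_sumr mulrA. Qed.

Lemma avgD F G : avg (fun t => F t + G t) = avg F + avg G.
Proof. by rewrite /avg big_split mulrDl. Qed.

Lemma avg_sum (I : finType) (P : pred I) (F : I -> T -> algR) :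
  avg (fun t => \sum_(i | P i) F i t) = \sum_(i | P i) avg (F i).
Proof. by rewrite /avg exchange_big mulr_suml. Qed.

(* After normalising every [phi i] to have average 1 this is the AM-GM
   inequality applied pointwise. *)
Lemma holder (I : finType) (phi : I -> T -> algR) (h : T -> algR) :
  (0 < #|I|)%N -> (forall i t, 0 <= phi i t) -> (forall t, 0 <= h t) ->
  (forall t, h t ^+ #|I| = \prod_i phi i t) ->
  avg h ^+ #|I| <= \prod_i avg (phi i).
Proof.
set m := #|I| => m0 phi0 h0 hE.
have a0 i : 0 <= avg (phi i) by apply: avg_ge0.
have [/existsP[i /eqP i0]|] := boolP [exists i, avg (phi i) == 0].
  suff -> : avg h = 0 by rewrite expr0n -[m == _]negbK -lt0n m0 prodr_ge0.
  have [T0|Tn0] := eqVneq #|T| 0%N; first by rewrite /avg T0 invr0 mulr0.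
  rewrite /avg big1 ?mul0r // => t _; apply/eqP.
  have : \sum_t phi i t == 0.
    move/eqP: i0; rewrite mulf_eq0 invr_eq0 pnatr_eq0 (negbTE Tn0) orbF.
    by [].
  rewrite psumr_eq0 // => /allP/(_ t (mem_index_enum _)) /eqP phit.
  by rewrite -(expf_eq0 _ m) || (have := hE t; rewrite (bigD1 i) //= phit mul0r => /eqP; rewrite expf_eq0 m0).
rewrite negb_exists => /forallP an0.
have ap i : 0 < avg (phi i) by rewrite lt_def an0 a0.
have Pp : 0 < \prod_i avg (phi i) by apply: prodr_gt0.
have [y y0 yE] := algR_root (ltW Pp) m0.
have yp : 0 < y by rewrite lt_def y0 andbT; apply/eqP => z; move: Pp; rewrite -yE z expr0n -[m == _]negbK -lt0n m0 ltxx.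
rewrite -yE ler_pXn2r ?nnegrE ?avg_ge0 //.
have pt t : h t <= y * ((\sum_i phi i t / avg (phi i)) / m%:R).
  rewrite -ler_pdivrMl //.
  have s0 : 0 <= (\sum_i phi i t / avg (phi i)) / m%:R.
    by rewrite divr_ge0 ?ler0n // sumr_ge0 // => i _; rewrite divr_ge0.
  rewrite -(ler_pXn2r m0) ?nnegrE // ?mulr_ge0 ?invr_ge0 //.
  rewrite exprMn exprVn yE hE mulrC -prodf_div.
  have /(_ (fun i _ => divr_ge0 (phi0 i t) (a0 i))) := @leif_AGM _ I predT (fun i => phi i t / avg (phi i)).
  by case.
apply: le_trans (avg_le pt) _; rewrite avgZ.
rewrite -[leRHS]mulr1 ler_wpM2l //.
rewrite -/(avg _) /avg -mulr_suml exchange_big /=.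
rewrite (eq_bigr (fun i : I => #|T|%:R)); last first.
  move=> i _; rewrite -mulr_suml; have := an0 i; rewrite /avg.
  rewrite mulf_eq0 negb_or invr_eq0 => /andP[s0 t0].
  by rewrite invf_div mulrA mulrC mulrA mulVf ?mul1r.
rewrite sumr_const -/m -[_ *+ m]mulr_natr mulfK ?pnatr_eq0 -?lt0n //.
have [->|Tn0] := eqVneq (#|T|%:R : algR) 0; first by rewrite mul0r ler01.
by rewrite divff.
Qed.

(** Apply [holder] to [a] copies of [A] and [b] copies of [B]. Giving [h] only through its power
    avoids fractional exponents. *)
Lemma holder2 (a b : nat) (A B h : T -> algR) :
  (0 < a + b)%N -> (forall t, 0 <= A t) -> (forall t, 0 <= B t) ->
  (forall t, 0 <= h t) -> (forall t, h t ^+ (a + b) = A t ^+ a * B t ^+ b) ->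
  avg h ^+ (a + b) <= avg A ^+ a * avg B ^+ b.
Proof.
move=> ab A0 B0 h0 hE.
pose phi (i : 'I_a + 'I_b) t := if i is inl _ then A t else B t.
have cE : #|{: 'I_a + 'I_b}| = (a + b)%N by rewrite card_sum !card_ord.
have := @holder _ phi h; rewrite cE => /(_ ab).
have -> : \prod_i avg (phi i) = avg A ^+ a * avg B ^+ b.
  rewrite big_sumType -[in RHS](card_ord a) -[in RHS](card_ord b) -!prodr_const.
  by congr (_ * _); apply: eq_bigr.
apply=> //; first by case.
by move=> t; rewrite hE big_sumType /= !prodr_const !card_ord.
Qed.

Lemma holder_prod (k : nat) (u : 'I_k -> T -> algR) :
  (0 < k)%N -> (forall i t, 0 <= u i t) ->
  avg (fun t => \prod_i u i t) ^+ k <= \prod_i avg (fun t => u i t ^+ k).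
Proof.
move=> k0 u0; have := @holder 'I_k (fun i t => u i t ^+ k) (fun t => \prod_i u i t).
rewrite card_ord; apply=> // [i t|t|t]; first by rewrite exprn_ge0.
  by rewrite prodr_ge0.
by rewrite prodrXl.
Qed.

End Averages.

(** * Moduli of complex numbers and pointwise bounds for sums *)

Definition absC (z : algC) : algR := in_algR (normr_real z).
Definition sqn (z : algC) : algR := absC z ^+ 2.

Lemma absC_ge0 z : 0 <= absC z. Proof. exact: normr_ge0. Qed.
Lemma sqn_ge0 z : 0 <= sqn z. Proof. by rewrite exprn_ge0 // absC_ge0. Qed.
#[local] Hint Resolve absC_ge0 sqn_ge0 : core.
Lemma absCM : {morph absC : x y / x * y}.
Proof. by move=> x y; apply: val_inj; rewrite rmorphM /= normrM. Qed.
Lemma absC1 : absC 1 = 1.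
Proof. by apply: val_inj; rewrite /= normr1. Qed.
Lemma sqnM : {morph sqn : x y / x * y}.
Proof. by move=> x y; rewrite /sqn absCM exprMn. Qed.
Lemma sqn1 : sqn 1 = 1. Proof. by rewrite /sqn absC1 expr1n. Qed.
Lemma sqn_prod (I : finType) (P : pred I) (F : I -> algC) :
  sqn (\prod_(i | P i) F i) = \prod_(i | P i) sqn (F i).
Proof. exact: (big_morph _ sqnM sqn1). Qed.
Lemma sqnE z : algRval (sqn z) = z * z^*.
Proof. by rewrite rmorphXn /= normCK. Qed.
Lemma absC_sum (I : finType) (P : pred I) (F : I -> algC) :
  absC (\sum_(i | P i) F i) <= \sum_(i | P i) absC (F i).
Proof.
elim/big_ind2: _ => //; first by rewrite /absC -[_ <= _]/(`|0| <= 0 :> algC) normr0.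
move=> x1 x2 y1 y2 l1 l2; apply: le_trans (lerD l1 l2).
exact: (ler_normD x2 y2).
Qed.

Lemma exists_max (I : finType) (i0 : I) (c : I -> algR) :
  exists j, forall i, c i <= c j.
Proof.
by case: (@Order.TotalTheory.arg_maxP _ _ _ i0 predT c isT) => j _ jm; exists j => i; apply: jm.
Qed.

(** Every summand is replaced by the largest one. The wasteful power of [#|I|] is affordable in
    [vino_start], where it is repaid by [range_exponent1]. *)
Lemma sqn_sum_crude (I : finType) (F : I -> algC) t :
  (0 < #|I|)%N -> sqn (\sum_i F i) ^+ t <= #|I|%:R ^+ (2 * t) * \sum_i sqn (F i) ^+ t.
Proof.
move=> /card_gt0P[i0 _].
have [j jm] := exists_max i0 (fun i => absC (F i)).
have le1 : absC (\sum_i F i) <= #|I|%:R * absC (F j).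
  apply: le_trans (absC_sum _ _) _.
  apply: le_trans (ler_sum _ (fun i _ => jm i)) _.
  by rewrite sumr_const mulr_natl.
rewrite {1}/sqn.
apply: le_trans (_ : (#|I|%:R * absC (F j)) ^+ (2 * t) <= _).
  by rewrite -exprM lerXn2r ?nnegrE ?mulr_ge0 ?ler0n.
rewrite exprMn mulnC ler_wpM2l ?exprn_ge0 ?ler0n //.
rewrite (bigD1 j) //= /sqn -exprM mulnC lerDl sumr_ge0 // => i _.
by rewrite exprn_ge0 // exprn_ge0.
Qed.

(** Let [m] be the largest modulus and [T] the indices of modulus at least m/p. If [T] has [k]
    members, the sum is at most p^2 times the modulus at each of them; otherwise it is at most
    (k-1)m + p(m/p) = km. The narrow constant is thus free of [p]. *)
Lemma broad_narrow (p k u : nat) (F : 'I_p -> algC) : (0 < p)%N -> (0 < k)%N ->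
  sqn (\sum_i F i) ^+ (k * u) <=
    k%:R ^+ (2 * (k * u)) * \sum_i sqn (F i) ^+ (k * u) +
    p%:R ^+ (4 * (k * u)) *
      \sum_(z : {ffun 'I_k -> 'I_p} | injectiveb z) \prod_j sqn (F (z j)) ^+ u.
Proof.
case: p F => // p F _ k0.
have [j0 jm] := exists_max ord0 (fun i => absC (F i)).
set m := absC (F j0) in jm; pose q : algR := p.+1%:R.
have q0 : 0 < q by rewrite ltr0n.
have m0 : 0 <= m := absC_ge0 _.
pose T := [set i | m <= q * absC (F i)].
have S1 : 0 <= \sum_i sqn (F i) ^+ (k * u) by rewrite sumr_ge0 // => i _; rewrite exprn_ge0.
have S2 : 0 <= \sum_(z : {ffun 'I_k -> 'I_p.+1} | injectiveb z) \prod_j sqn (F (z j)) ^+ u.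
  by rewrite sumr_ge0 // => z _; rewrite prodr_ge0 // => i _; rewrite exprn_ge0.
have [kT|Tk] := leqP k #|T|.
  apply: (@le_trans _ _ (q ^+ (4 * (k * u)) *
      \sum_(z : {ffun 'I_k -> 'I_p.+1} | injectiveb z) \prod_j sqn (F (z j)) ^+ u)).
    pose z := [ffun j : 'I_k => enum_val (widen_ord kT j)].
    have zi : injectiveb z.
      apply/injectiveP => i j; rewrite !ffunE => /enum_val_inj /(congr1 val) /= ij.
      exact: val_inj.
    rewrite (bigD1 z) //= mulrDr.
    apply: (@le_trans _ _ (q ^+ (4 * (k * u)) * \prod_j sqn (F (z j)) ^+ u)); last first.
      rewrite lerDl mulr_ge0 ?exprn_ge0 ?ler0n // sumr_ge0 // => y _.
      by rewrite prodr_ge0 // => i _; rewrite exprn_ge0.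
    have -> : q ^+ (4 * (k * u)) * \prod_j sqn (F (z j)) ^+ u = \prod_j (q ^+ 4 * sqn (F (z j))) ^+ u.
      under [RHS]eq_bigr => j _ do rewrite exprMn.
      by rewrite big_split /= prodr_const card_ord -!exprM [(u * k)%N]mulnC.
    have -> : sqn (\sum_i F i) ^+ (k * u) = \prod_(j < k) sqn (\sum_i F i) ^+ u.
      by rewrite prodr_const card_ord -exprM mulnC.
    apply: ler_prod => j _; rewrite exprn_ge0 //=.
    rewrite lerXn2r ?nnegrE ?mulr_ge0 ?exprn_ge0 ?ler0n // /sqn.
    have -> : q ^+ 4 * absC (F (z j)) ^+ 2 = (q * (q * absC (F (z j)))) ^+ 2 by ring.
    rewrite lerXn2r ?nnegrE ?mulr_ge0 ?ler0n // .
    apply: le_trans (absC_sum _ _) _.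
    apply: le_trans (ler_sum _ (fun i _ => jm i)) _.
    rewrite sumr_const card_ord -mulr_natl ler_wpM2l ?ler0n //.
    have := enum_valP (widen_ord kT j); rewrite inE /z ffunE; exact.
  by rewrite lerDr mulr_ge0 ?exprn_ge0 ?ler0n.
apply: (@le_trans _ _ (k%:R ^+ (2 * (k * u)) * \sum_i sqn (F i) ^+ (k * u))); last first.
  by rewrite lerDl mulr_ge0 ?exprn_ge0 ?ler0n.
have le1 : absC (\sum_i F i) <= k%:R * m.
  apply: le_trans (absC_sum _ _) _.
  rewrite (bigID (mem T)) /=.
  have l1 : \sum_(i in T) absC (F i) <= #|T|%:R * m.
    apply: le_trans (ler_sum _ (fun i _ => jm i)) _.
    by rewrite sumr_const mulr_natl.
  have l2 : \sum_(i | i \notin T) absC (F i) <= m.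
    apply: (@le_trans _ _ (\sum_(i < p.+1) m / q)).
      rewrite [leRHS](bigID (mem T)) /= ler_wpDl //.
        by rewrite sumr_ge0 // => i _; rewrite divr_ge0 // ltW.
      apply: ler_sum => i; rewrite inE -ltNge => /ltW.
      by rewrite ler_pdivlMr // mulrC.
    by rewrite sumr_const card_ord -mulr_natl mulrCA divff ?mulr1 // gt_eqF.
  apply: le_trans (lerD l1 l2) _.
  by rewrite -{2}(mul1r m) -mulrDl ler_wpM2r // natr1 ler_nat.
have le2 : sqn (\sum_i F i) ^+ (k * u) <= (k%:R * m) ^+ (2 * (k * u)).
  have km0 : 0 <= k%:R * m by rewrite mulr_ge0 ?ler0n.
  rewrite [leRHS]exprM; apply: lerXn2r; rewrite ?nnegrE ?exprn_ge0 //.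
  by rewrite /sqn; apply: lerXn2r; rewrite ?nnegrE.
apply: le_trans le2 _; rewrite exprMn ler_wpM2l ?exprn_ge0 ?ler0n //.
rewrite (bigD1 j0) //= [m ^+ _]exprM lerDl sumr_ge0 // => i _.
by rewrite exprn_ge0.
Qed.

Lemma sqn_sum_le (I : finType) (P : pred I) (F : I -> algC) :
  sqn (\sum_(i | P i) F i) <= #|P|%:R * \sum_(i | P i) sqn (F i).
Proof.
apply: (@le_trans _ _ ((\sum_(i | P i) absC (F i)) ^+ 2)).
  by rewrite lerXn2r ?nnegrE ?absC_ge0 ?absC_sum ?sumr_ge0.
have [P0|P0] := posnP #|P|.
  rewrite !big_pred0 ?expr0n ?mulr0 //; try by move=> i; have := card0_eq P0 i.
set n : algR := #|P|%:R; have n0 : 0 < n by rewrite ltr0n.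
set s := \sum_(i | P i) absC (F i).
(* The variance of the moduli, scaled to avoid division, is nonnegative; expanding it yields
   Cauchy-Schwarz. *)
have : 0 <= \sum_(i | P i) (n * absC (F i) - s) ^+ 2 by rewrite sumr_ge0 // => i _; rewrite sqr_ge0.
rewrite (eq_bigr (fun i => n ^+ 2 * sqn (F i) - (2 * n * s) * absC (F i) + s ^+ 2)); last first.
  by move=> i _; rewrite /sqn; ring.
have sE : \sum_(i | P i) s ^+ 2 = n * s ^+ 2 by rewrite sumr_const mulr_natl.
rewrite big_split /= sE sumrB -!mulr_sumr -/s.
set t := \sum_(i | P i) _ => h.
have : 0 <= n * (n * t - s ^+ 2) by apply: le_trans h _; rewrite le_eqVlt; apply/orP; left; apply/eqP; ring.
by rewrite pmulr_rge0 // subr_ge0.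
Qed.

(** * Exponential sums *)

Section Fourier.
Variables (k N : nat) (z : algC).
Hypotheses (N_gt0 : (0 < N)%N) (prim_z : N.-primitive_root z).

Notation Om := {ffun 'I_k -> 'I_N}.

Definition echar (al : Om) (v : 'I_k -> nat) : algC := \prod_j z ^+ (al j * v j).

Definition tsum (U : finType) (A : {set U}) (v : U -> 'I_k -> nat) (al : Om) : algC :=
  \sum_(u in A) echar al (v u).

Lemma echarD al v w : echar al (fun j => v j + w j)%N = echar al v * echar al w.
Proof.
rewrite /echar -big_split /=; apply: eq_bigr => j _.
by rewrite mulnDr exprD.
Qed.

Lemma echar_sum al (I : finType) (P : pred I) (v : I -> 'I_k -> nat) :
  echar al (fun j => \sum_(i | P i) v i j)%N = \prod_(i | P i) echar al (v i).
Proof.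
rewrite /echar exchange_big /=; apply: eq_bigr => j _.
by rewrite -expr_sum big_distrr.
Qed.

Let zz_conj n : z ^+ n * (z ^+ n)^* = 1.
Proof.
have zn1 : `|z ^+ n| == 1.
  by rewrite -(pexpr_eq1 N_gt0) // -normrX exprAC (prim_expr_order prim_z) expr1n normr1.
by rewrite -normCK (eqP zn1) expr1n.
Qed.

(** The sum factors into [k] geometric sums of roots of unity. Entries below [N] make congruence
    modulo [N] the same as equality, so the finite group detects integer equations exactly. *)
Lemma echar_orth (v w : 'I_k -> nat) :
  (forall j, (v j < N)%N) -> (forall j, (w j < N)%N) ->
  \sum_(al : Om) echar al v * (echar al w)^* =
  if [forall j, v j == w j] then N%:R ^+ k else 0.
Proof.
move=> vN wN; pose r j := z ^+ v j * (z ^+ w j)^*.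
transitivity (\sum_(al : Om) \prod_j r j ^+ al j).
  apply: eq_bigr => al _; rewrite /echar rmorph_prod -big_split /=.
  apply: eq_bigr => j _.
  by rewrite /r exprMn -rmorphXn -!exprM ![(_ * al j)%N]mulnC.
rewrite -(bigA_distr_bigA (fun j (a : 'I_N) => r j ^+ a)) /=.
have rN j : r j ^+ N = 1.
  rewrite exprMn -rmorphXn -!exprM ![(_ * N)%N]mulnC !exprM.
  by rewrite (prim_expr_order prim_z) !expr1n rmorph1 mulr1.
case: ifPn => [/forallP vw|].
  rewrite (eq_bigr (fun=> N%:R)); first by rewrite prodr_const card_ord.
  move=> j _; rewrite (eq_bigr (fun=> 1)); first by rewrite sumr_const card_ord.
  by move=> a _; rewrite /r (eqP (vw j)) zz_conj expr1n.
rewrite negb_forall => /existsP[j vwj]; rewrite (bigD1 j) //=.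
suff -> : \sum_(a < N) r j ^+ a = 0 by rewrite mul0r.
have r1 : r j - 1 != 0.
  rewrite subr_eq0; apply: contra vwj => /eqP rj1.
  have : z ^+ v j == z ^+ w j.
    by rewrite -[_ ^+ v j]mulr1 -(zz_conj (w j)) [X in _ * X]mulrC mulrA -/(r j) rj1 mul1r.
  by rewrite (eq_prim_root_expr prim_z) !modn_small.
by apply: (mulfI r1); rewrite mulr0 -subrX1 rN subrr.
Qed.

Lemma mean_sq (U : finType) (A : {set U}) (v : U -> 'I_k -> nat) :
  (forall u j, u \in A -> (v u j < N)%N) ->
  avg (fun al => sqn (tsum A v al)) =
  #|[set uu | [&& uu.1 \in A, uu.2 \in A & [forall j, v uu.1 j == v uu.2 j]]]|%:R.
Proof.
move=> vN; apply: (@fmorph_inj _ _ algRval); rewrite /avg fmorph_div rmorph_sum !rmorph_nat /=.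
rewrite (eq_bigr (fun al => \sum_(u in A) \sum_(u' in A) echar al (v u) * (echar al (v u'))^*)); last first.
  move=> al _; etransitivity; first exact: sqnE. rewrite rmorph_sum mulr_suml; apply: eq_bigr => u _.
  by rewrite mulr_sumr.
rewrite exchange_big /=.
under eq_bigr => u _ do rewrite exchange_big /=.
rewrite (eq_bigr (fun u => \sum_(u' in A) (if [forall j, v u j == v u' j] then N%:R ^+ k else 0))); last first.
  move=> u uA; apply: eq_bigr => u' u'A; rewrite echar_orth // => j; exact: vN.
rewrite pair_big /= -big_mkcondr /= sumr_const.
rewrite card_ffun !card_ord. rewrite -[X in X / _]mulr_natr natrX mulrAC divff ?mul1r; last first.
  by rewrite expf_neq0 // pnatr_eq0 -lt0n.
congr (_%:R); apply: eq_card => -[u u']; rewrite !inE /= .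
by rewrite unfold_in /= andbA.
Qed.

(* Grouping the frequencies by a label that every coincidence preserves splits
   the mean value; Cauchy-Schwarz inside a label class with at most [M] cells
   then costs the factor [M]. *)
Lemma mean_split (U Y L Z : finType) (A : {set U}) (B : {set Y})
   (v : U -> 'I_k -> nat) (w : Y -> 'I_k -> nat)
   (cell : U -> Z) (lab : Z -> L) (D : {set Z}) (M : nat) :
  (forall u y j, u \in A -> y \in B -> (v u j + w y j < N)%N) ->
  (forall u, u \in A -> cell u \in D) ->
  (forall u u' y y', u \in A -> u' \in A -> y \in B -> y' \in B ->
    (forall j, v u j + w y j = v u' j + w y' j)%N -> lab (cell u) = lab (cell u')) ->
  (forall l, (#|[set c in D | lab c == l]| <= M)%N) ->
  avg (fun al => sqn (tsum A v al) * sqn (tsum B w al)) <=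
  M%:R * \sum_(c in D) avg (fun al => sqn (tsum [set u in A | cell u == c] v al) * sqn (tsum B w al)).
Proof.
move=> vwN AD labP cardM.
pose A' l := [set u in A | lab (cell u) == l].
have mulE (X : {set U}) al : sqn (tsum X v al) * sqn (tsum B w al) =
    sqn (tsum (setX X B) (fun uy j => v uy.1 j + w uy.2 j)%N al).
  rewrite -sqnM; congr sqn; rewrite /tsum big_distrlr /=.
  rewrite pair_big /=; apply: eq_big => [[u y]|[u y] _] /=; first by rewrite inE.
  by rewrite echarD.
(* Both sides count coincidences by [mean_sq], and the two halves of a coincidence carry the same
   label. *)
have split_lab : avg (fun al => sqn (tsum A v al) * sqn (tsum B w al)) =
    \sum_l avg (fun al => sqn (tsum (A' l) v al) * sqn (tsum B w al)).
  rewrite (eq_avg (mulE A)) mean_sq; last first.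
    by case=> u y j; rewrite inE => /andP[]; apply: vwN.
  rewrite [RHS](eq_bigr _ (fun l _ => etrans (eq_avg (mulE (A' l))) (mean_sq _))).
  2: by move=> l _ [u y] j; rewrite !inE /= => /andP[/andP[uA _] yB]; apply: vwN.
  rewrite -natr_sum; congr (_%:R).
  rewrite -sum1_card (partition_big (fun uu => lab (cell uu.1.1)) predT) //=.
  apply: eq_bigr => l _; rewrite -sum1_card; apply: eq_bigl => -[[u y] [u' y']].
  rewrite !inE /=.
  case: (boolP (u \in A)) => //= uA; case: (boolP (y \in B)) => //= yB; last first.
    by rewrite !andbF.
  case: (boolP (u' \in A)) => //= u'A; last by rewrite !andbF.
  case: (boolP (y' \in B)) => //= y'B; last by rewrite !andbF.
  rewrite !andbT; case: eqP => [<-|ne]; rewrite ?andbF ?andbT //=.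
  case: (boolP [forall j, _]) => [/forallP e|]; last by rewrite andbF.
    rewrite (labP u u' y y') ?eqxx // => j; exact/eqP/e.
rewrite split_lab.
have le_l l : avg (fun al => sqn (tsum (A' l) v al) * sqn (tsum B w al)) <=
   M%:R * \sum_(c in D | lab c == l) avg (fun al => sqn (tsum [set u in A | cell u == c] v al) * sqn (tsum B w al)).
  rewrite -avg_sum -avgZ; apply: avg_le => al.
  rewrite -mulr_suml mulrA ler_wpM2r ?sqn_ge0 //.
  have -> : tsum (A' l) v al = \sum_(c in [set c in D | lab c == l]) tsum [set u in A | cell u == c] v al.
    rewrite /tsum (partition_big cell (mem [set c in D | lab c == l])) /=; last first.
      by move=> u; rewrite !inE => /andP[uA ->]; rewrite AD.
    apply: eq_bigr => c; rewrite inE => /andP[_ /eqP lc]; apply: eq_bigl => u.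
    rewrite !inE; have [->|] := eqVneq (cell u) c; rewrite ?andbF // lc eqxx !andbT //.
  set E := [set c in D | lab c == l].
  rewrite [X in _ <= _ * X](eq_bigl (mem E)); last by move=> c; rewrite !inE.
  apply: le_trans (_ : #|E|%:R * \sum_(c in E) sqn (tsum [set u in A | cell u == c] v al) <= _).
    exact: sqn_sum_le.
  rewrite ler_wpM2r ?ler_nat //; first by rewrite sumr_ge0 // => c _; apply: sqn_ge0.
  exact: cardM.
apply: le_trans (ler_sum _ (fun l _ => le_l l)) _.
rewrite -mulr_sumr ler_wpM2l ?ler0n // [leRHS](partition_big lab predT) //=.
Qed.

End Fourier.

(** * Counting congruences *)

Lemma eqmod_dvdz (d x y : nat) : (x == y %[mod d]) = (d %| x%:Z - y%:Z)%Z.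
Proof. by rewrite -eqz_mod_dvd !modz_nat. Qed.

Lemma Posz_power_sum (I : finType) (y : I -> nat) j :
  (\sum_i y i ^ j)%N%:Z = \sum_i (y i)%:Z ^+ j.
Proof.
rewrite -natz natr_sum; apply: eq_bigr => i _.
by rewrite natrX natz.
Qed.

Lemma card_residue_class (p m b e : nat) : (0 < p)%N -> (b <= m)%N ->
  (#|[set x : 'I_(p ^ m) | x == e %[mod p ^ b]]| <= p ^ (m - b))%N.
Proof.
move=> p0 bm; have pb0 : (0 < p ^ b)%N by rewrite expn_gt0 p0.
have lt (x : 'I_(p ^ m)) : (x %/ p ^ b < p ^ (m - b))%N.
  by rewrite ltn_divLR // -expnD subnK.
rewrite -[leqRHS]card_ord -(@card_in_imset _ _ (fun x => Ordinal (lt x))).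
  exact: max_card.
move=> x y; rewrite !inE => /eqP xe /eqP ye /(congr1 val) /= xy; apply: val_inj => /=.
by rewrite (divn_eq x (p ^ b)) (divn_eq y (p ^ b)) xy xe ye.
Qed.

Lemma power_sum_affine (I : finType) (a e : int) (y : I -> int) j :
  \sum_i (a * y i + e) ^+ j =
  \sum_(l < j.+1) (e ^+ (j - l) * a ^+ l *+ 'C(j, l)) * \sum_i y i ^+ l.
Proof.
under eq_bigr => i _ do rewrite addrC exprDn.
rewrite exchange_big /=; apply: eq_bigr => l _; rewrite mulr_sumr.
by apply: eq_bigr => i _; rewrite exprMn mulrnAl mulrA.
Qed.

Lemma card_ord_ltn n m : (#|[pred q : 'I_n | (q < m)%N]| <= m)%N.
Proof.
case: m => [|m]; first by rewrite eq_card0.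
rewrite -[leqRHS]card_ord -(@card_in_image _ _ (fun q : 'I_n => inord q : 'I_m.+1)).
  exact: max_card.
move=> q q'; rewrite !inE => qm q'm /(congr1 val) /=; rewrite !inordK // => /val_inj.
exact.
Qed.

Section PrimePower.
Variables (p k : nat).
Hypotheses (p_pr : prime p) (kp : (k < p)%N).

(** Evaluate [power_sums_prod] at [y' i]: the product of the differences [y' i - y i'] vanishes, and
    every factor with [i' != i] is a unit because the residues modulo [p] differ. Hence the
    remaining factor is 0. *)
Lemma power_sums_inj_mod m (y y' : 'I_k -> nat) : (0 < m)%N ->
  (forall j, (1 <= j <= k)%N -> \sum_i y i ^ j = \sum_i y' i ^ j %[mod p ^ m])%N ->
  (forall i i', y' i = y i' %[mod p] -> i = i')%N ->
  forall i, y i = y' i %[mod p ^ m].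
Proof.
move=> m0 yy' inj i; have n1 : (1 < p ^ m)%N by rewrite -(expn0 p) ltn_exp2l // prime_gt1.
have natZ (u v : nat) : (u%:R == v%:R :> 'Z_(p ^ m)) = (u == v %[mod p ^ m]).
  by rewrite -val_eqE /= !val_Zp_nat.
have unitZ u : ~~ (p %| u)%N -> u%:R \is a @GRing.unit 'Z_(p ^ m).
  by move=> pu; rewrite unitZpE // coprimeXl // prime_coprime.
have uk j : (1 <= j <= k)%N -> j%:R \is a @GRing.unit 'Z_(p ^ m).
  case/andP=> j1 jk; apply: unitZ; rewrite gtnNdvd //.
  exact: leq_ltn_trans jk kp.
have := @power_sums_prod 'Z_(p ^ m) k (fun i => (y i)%:R) (fun i => (y' i)%:R) uk.
have H j : (1 <= j <= k)%N -> \sum_(i < k) ((y i)%:R : 'Z_(p ^ m)) ^+ j = \sum_(i < k) (y' i)%:R ^+ j.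
  move=> jk; under eq_bigr do rewrite -natrX.
  under [RHS]eq_bigr do rewrite -natrX.
  by rewrite -!natr_sum; apply/eqP; rewrite natZ; apply/eqP/yy'.
move=> /(_ H (y' i)%:R); rewrite [RHS](bigD1 i) //= subrr mul0r (bigD1 i) //= => e0.
have U : \prod_(i' < k | i' != i) ((y' i)%:R - (y i')%:R) \is a @GRing.unit 'Z_(p ^ m).
  apply: rpred_prod => i' ii'.
  have [le|/ltnW le] := leqP (y i') (y' i).
    rewrite -natrB //; apply: unitZ; rewrite -eqn_mod_dvd //.
    by apply: contra ii' => /eqP/inj ->.
  rewrite -opprB unitrN -natrB //; apply: unitZ; rewrite -eqn_mod_dvd //.
  by apply: contra ii' => /eqP/esym/inj ->.
apply/eqP; rewrite -natZ eq_sym -subr_eq0; apply/eqP.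
by apply: (mulIr U); rewrite mul0r.
Qed.

(* The conditioned tuples of efficient congruencing. *)
Definition adm a (xi : 'I_k -> nat) :=
  (forall i i', xi i = xi i' %[mod p ^ a]) /\
  (forall i i', xi i = xi i' %[mod p ^ a.+1] -> i = i').

(** The shift [c] serves to move a residue class modulo [p ^ b] to 0, where [j]-th powers vanish
    modulo [p ^ (j * b)]. *)
Definition congr_set a b c (xi l : 'I_k -> nat) :=
  [set z : {ffun 'I_k -> 'I_(p ^ (k * b))} |
    [forall i, z i == xi i %[mod p ^ a.+1]] &&
    [forall j : 'I_k, (\sum_i (z i + c) ^ j.+1)%N == l j %[mod p ^ (j.+1 * b)]]].

(* Writing [z i = p ^ a * y i + r], the [j]-th condition together with the
   exact values of the lower power sums of [y] fixes the [j]-th power sum of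
   [y] modulo [p ^ (j * (b - a))]; the remaining digits up to [p ^ (k b - a)]
   are free, and Newton's identities recover [y]. *)
Lemma card_congr_set a b c (xi l : 'I_k -> nat) : (0 < k)%N -> (a < b)%N -> adm a xi ->
  (#|congr_set a b c xi l| <= p ^ ('C(k, 2) * (a + b)))%N.
Proof.
move=> k0 ab [xi1 xi2]; have p0 := prime_gt0 p_pr.
pose i0 := Ordinal k0; pose r := (xi i0 %% p ^ a)%N; pose m := (k * b - a)%N.
have am : (a + m = k * b)%N by rewrite /m; nia.
have m0 : (0 < m)%N by rewrite /m; nia.
have jm j : (j <= k)%N -> (j * (b - a) <= m)%N by rewrite /m; nia.
have pa0 : (0 < p ^ a)%N by rewrite expn_gt0 p0.
pose y (z : {ffun 'I_k -> 'I_(p ^ (k * b))}) i := (z i %/ p ^ a)%N.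
pose S z j := (\sum_i y z i ^ j)%N.
have zE z i : z \in congr_set a b c xi l -> (z i = y z i * p ^ a + r :> nat)%N.
  rewrite inE => /andP[/forallP/(_ i) /eqP zi _].
  rewrite {1}(divn_eq (z i) (p ^ a)); congr (_ + _)%N.
  rewrite /r -(xi1 i i0).
  have := congr1 (fun t => t %% p ^ a)%N zi.
  by rewrite !modn_dvdm // dvdn_exp2l.
have qlt z (j : 'I_k) : (S z j.+1 %% p ^ m %/ p ^ (j.+1 * (b - a)) < p ^ m)%N.
  by apply: leq_ltn_trans (leq_div _ _) _; rewrite ltn_pmod // expn_gt0 p0.
(* [h] records the digits of the power sums of [y z] that the congruences leave free. *)
pose h z : {ffun 'I_k -> 'I_(p ^ m)} := [ffun j => Ordinal (qlt z j)].
have hinj : {in congr_set a b c xi l &, injective h}.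
  move=> z z' zZ z'Z hz.
  pose dl j : int := (S z j)%:Z - (S z' j)%:Z.
  have dlE j : dl j = \sum_i (y z i)%:Z ^+ j - \sum_i (y z' i)%:Z ^+ j.
    by rewrite /dl /S !Posz_power_sum.
  have dl_m j : (j <= k)%N -> ((p ^ m)%N %| dl j)%Z.
    elim/ltn_ind: j => -[|j] IH jk; first by rewrite dlE subrr dvdz0.
    pose j' := Ordinal jk.
    have epsE : ((p ^ (j.+1 * b))%N %| \sum_i ((z i + c)%N%:Z ^+ j.+1) - \sum_i ((z' i + c)%N%:Z ^+ j.+1))%Z.
      move: (zZ) (z'Z); rewrite !inE => /andP[_ /forallP/(_ j')/eqP e1] /andP[_ /forallP/(_ j')/eqP e2].
      have : (\sum_i (z i + c) ^ j.+1)%N == (\sum_i (z' i + c) ^ j.+1)%N %[mod p ^ (j.+1 * b)].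
        by apply/eqP; rewrite e1 e2.
      by rewrite eqmod_dvdz !Posz_power_sum.
    have aff (x : {ffun 'I_k -> 'I_(p ^ (k * b))}) : x \in congr_set a b c xi l ->
      \sum_i ((x i + c)%N%:Z ^+ j.+1) = \sum_i ((p ^ a)%N%:Z * (y x i)%:Z + (r + c)%N%:Z) ^+ j.+1.
      move=> xZ; apply: eq_bigr => i _; rewrite (zE _ _ xZ); congr (_ ^+ _).
      by rewrite -PoszM -PoszD addnA mulnC.
    have epsS : \sum_i ((z i + c)%N%:Z ^+ j.+1) - \sum_i ((z' i + c)%N%:Z ^+ j.+1) =
        \sum_(t < j.+2) ((r + c)%N%:Z ^+ (j.+1 - t) * (p ^ a)%N%:Z ^+ t *+ 'C(j.+1, t)) * dl t.
      rewrite (aff _ zZ) (aff _ z'Z) !power_sum_affine -sumrB.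
      by apply: eq_bigr => t _; rewrite -mulrBr -dlE.
    rewrite epsS in epsE.
    (* The terms of index 1 <= t <= j drop out: by induction [dl t] is divisible by p^(kb-a), and at
       + kb - a >= kb. The term [t = 0] is zero. *)
    have epsE' : ((p ^ (j.+1 * b))%N %| (p ^ (a * j.+1))%N%:Z * dl j.+1)%Z.
      have pX u v : (p ^ (u * v))%N%:Z = (p ^ u)%N%:Z ^+ v by rewrite expnM -!natz natrX.
      move: epsE; rewrite big_ord_recr /= rpredDl.
        by rewrite subnn expr0 mul1r binn mulr1n -pX.
      apply: rpred_sum => t _; case: (posnP t) => [->|t0].
        by rewrite dlE subrr mulr0 rpred0.
      rewrite -mulrnAl -mulrA; apply: dvdz_mull.
      have /dvdzP[s ->] := IH t (ltn_ord t) (leq_trans (ltnW (ltn_ord t)) jk).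
      rewrite -pX mulrCA; apply: dvdz_mull; rewrite -PoszM -expnD /=.
      by apply: dvdn_exp2l; nia.
    have dl_b : ((p ^ (j.+1 * (b - a)))%N %| dl j.+1)%Z.
      have E : (p ^ (j.+1 * b) = p ^ (a * j.+1) * p ^ (j.+1 * (b - a)))%N.
        by rewrite -expnD; congr (_ ^ _)%N; nia.
      move: epsE'; rewrite E PoszM dvdz_mul2l //.
      by rewrite gt_eqF // ltz_nat expn_gt0 p0.
    have eqS : (S z j.+1 %% p ^ m = S z' j.+1 %% p ^ m)%N.
      rewrite (divn_eq (S z j.+1 %% p ^ m) (p ^ (j.+1 * (b - a)))).
      rewrite [RHS](divn_eq _ (p ^ (j.+1 * (b - a)))).
      have := congr1 (fun f : {ffun 'I_k -> 'I_(p ^ m)} => val (f j')) hz.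
      rewrite !ffunE /= => ->; congr (_ + _)%N.
      rewrite !modn_dvdm ?dvdn_exp2l ?jm //.
      by apply/eqP; rewrite eqmod_dvdz.
    by move/eqP: eqS; rewrite eqmod_dvdz.
  have yeq := @power_sums_inj_mod m (y z) (y z') m0.
  apply/ffunP => i; apply: val_inj => /=.
  have ylt (x : {ffun 'I_k -> 'I_(p ^ (k * b))}) : (y x i < p ^ m)%N.
    by rewrite /y ltn_divLR // -expnD addnC am.
  rewrite (zE _ i zZ) (zE _ i z'Z); congr (_ * _ + _)%N.
  rewrite -(modn_small (ylt z)) -(modn_small (ylt z')); apply: yeq.
    move=> j /andP[_ jk]; apply/eqP; rewrite eqmod_dvdz; exact: dl_m.
  move=> i1 i2 e; apply: xi2.
  have xiE (x : {ffun 'I_k -> 'I_(p ^ (k * b))}) t : x \in congr_set a b c xi l -> x t = xi t %[mod p ^ a.+1].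
    by rewrite inE => /andP[/forallP/(_ t)/eqP].
  rewrite -(xiE _ i1 z'Z) -(xiE _ i2 zZ) (zE _ i1 z'Z) (zE _ i2 zZ).
  by apply/eqP; rewrite eqn_modDr expnS -!muln_modl e.
rewrite -(card_in_imset hinj).
pose F (j : 'I_k) := [pred q : 'I_(p ^ m) | (q < p ^ (m - j.+1 * (b - a)))%N].
apply: leq_trans (_ : #|family F| <= _)%N.
  apply/subset_leq_card/subsetP => f /imsetP[x _ ->]; apply/familyP => j.
  by rewrite inE ffunE /= ltn_divLR ?expn_gt0 ?p0 // -expnD subnK ?jm ?ltn_pmod ?expn_gt0 ?p0.
rewrite card_family foldrE big_map big_enum /=.
apply: leq_trans (_ : \prod_(j < k) p ^ (m - j.+1 * (b - a)) <= _)%N.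
  by apply: leq_prod => j _; apply: card_ord_ltn.
(* The free digits number k(kb-a) - (b-a)k(k+1)/2, which equals C(k,2)(a+b). *)
rewrite -expn_sum leq_pexp2l //.
have e1 : (\sum_(j < k) (m - j.+1 * (b - a)) + \sum_(j < k) j.+1 * (b - a) = k * m)%N.
  rewrite -big_split /= -[X in (X * m)%N](card_ord k) -sum_nat_const; apply: eq_bigr => j _.
  by rewrite subnK // jm.
have e2 : (\sum_(j < k) j.+1 = 'C(k, 2) + k)%N.
  rewrite -bin2_sum big_mkord -[X in (_ + X)%N](card_ord k) -sum1_card -big_split /=.
  by apply: eq_bigr => j _; rewrite addn1.
rewrite -big_distrl /= e2 in e1.
have e3 : ('C(k, 2) * 2 = k * k.-1)%N by rewrite -[k.-1]bin1 mul_bin_diag mulnC.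
move: e1 e3; rewrite /m; set X := (\sum_(j < k) _)%N; set C := 'C(k, 2).
clearbody X C.
have -> : b = (a + (b - a))%N by lia.
move: (b - a)%N => d; rewrite -(prednK k0) /=; set k' := k.-1.
have -> : (a + d - a = d)%N by lia.
have -> : (k'.+1 * (a + d) - a = k' * (a + d) + d)%N by lia.
move=> e1 e3.
have : (k'.+1 * (k' * (a + d)) = C * 2 * (a + d))%N by rewrite e3 mulnA.
lia.
Qed.
End PrimePower.

(** * Mixed mean values *)

(** The binomial expansion is triangular with diagonal entries a^j, so power sums are recovered
    degree by degree. This rescales a residue class to a shorter interval. *)
Lemma affine_power_sums_inj (I : finType) (k a r : nat) (y y' : I -> nat) :
  (0 < a)%N ->
  (forall j, (1 <= j <= k)%N -> \sum_i (a * y i + r) ^ j = \sum_i (a * y' i + r) ^ j)%N ->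
  forall j, (j <= k)%N -> (\sum_i y i ^ j = \sum_i y' i ^ j)%N.
Proof.
move=> a0 H; elim/ltn_ind => -[|j] IH jk; first by apply: eq_bigr.
have := congr1 Posz (H j.+1 jk); rewrite !Posz_power_sum.
have E (u : I -> nat) : \sum_i (a * u i + r)%N%:Z ^+ j.+1 = \sum_i (a%:Z * (u i)%:Z + r%:Z) ^+ j.+1.
  by apply: eq_bigr => i _; rewrite PoszD PoszM.
rewrite !E !power_sum_affine big_ord_recr [RHS]big_ord_recr /=.
have -> : \sum_(l < j.+1) (r%:Z ^+ (j.+1 - l) * a%:Z ^+ l *+ 'C(j.+1, l)) * (\sum_i (y i)%:Z ^+ l) =
          \sum_(l < j.+1) (r%:Z ^+ (j.+1 - l) * a%:Z ^+ l *+ 'C(j.+1, l)) * (\sum_i (y' i)%:Z ^+ l).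
  apply: eq_bigr => l _; congr (_ * _); rewrite -!Posz_power_sum IH //.
  exact: leq_trans (ltnW (ltn_ord l)) jk.
move/addrI; rewrite subnn expr0 mul1r binn mulr1n => /mulfI e.
apply/eqP; rewrite -eqz_nat; apply/eqP; rewrite !Posz_power_sum; apply: e.
by rewrite expf_neq0 // gt_eqF // ltz_nat.
Qed.

Lemma shift_power_sums (I I' : finType) (k c : nat) (x x' : I -> nat) (y y' : I' -> nat) :
  (forall j, (1 <= j <= k)%N ->
     \sum_i x i ^ j + \sum_i y i ^ j = \sum_i x' i ^ j + \sum_i y' i ^ j)%N ->
  forall j, (1 <= j <= k)%N ->
     (\sum_i (x i + c) ^ j + \sum_i (y i + c) ^ j =
      \sum_i (x' i + c) ^ j + \sum_i (y' i + c) ^ j)%N.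
Proof.
move=> H j /andP[_ jk].
have H' l : (l <= k)%N -> \sum_i (x i)%:Z ^+ l + \sum_i (y i)%:Z ^+ l =
   \sum_i (x' i)%:Z ^+ l + \sum_i (y' i)%:Z ^+ l.
  case: l => [|l] lk; first by congr (_ + _); apply: eq_bigr => i _.
  by have := congr1 Posz (H l.+1 lk); rewrite !PoszD !Posz_power_sum.
have E (I0 : finType) (u : I0 -> nat) : (\sum_i (u i + c) ^ j)%N%:Z =
    \sum_(l < j.+1) (c%:Z ^+ (j - l) * 1 ^+ l *+ 'C(j, l)) * \sum_i (u i)%:Z ^+ l.
  rewrite Posz_power_sum -power_sum_affine; apply: eq_bigr => i _.
  by rewrite mul1r PoszD.
apply/eqP; rewrite -eqz_nat !PoszD !E -!big_split /=; apply/eqP.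
apply: eq_bigr => l _; rewrite -!mulrDr H' //.
by apply: leq_trans jk; rewrite -ltnS.
Qed.

Definition vino_set (k t X : nat) :=
  [set xy : {ffun 'I_t -> 'I_X} * {ffun 'I_t -> 'I_X} |
    [forall j : 'I_k, (\sum_i xy.1 i ^ j.+1)%N == (\sum_i xy.2 i ^ j.+1)%N]].

(* [vino k t X] is Vinogradov's mean value [J_{t,k}(X)]. *)
Definition vino (k t X : nat) := #|vino_set k t X|.

Section MeanValues.
Variables (p k n N : nat) (z : algC).
Hypotheses (p_pr : prime p) (kp : (k < p)%N) (k_gt0 : (0 < k)%N).
Hypotheses (N_big : (k * k.+1 * (p ^ n) ^ k < N)%N) (prim_z : N.-primitive_root z).

Notation X := (p ^ n)%N.
Notation Om := {ffun 'I_k -> 'I_N}.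

Let N_gt0 : (0 < N)%N. Proof. exact: leq_trans N_big. Qed.
Let p_gt0 : (0 < p)%N. Proof. exact: prime_gt0. Qed.

Definition pow_vec (I : finType) (x : {ffun I -> 'I_X}) (j : 'I_k) : nat := (\sum_i x i ^ j.+1)%N.

(** With at most [k * k.+1] variables, [N_big] then keeps all entries below [N], as [mean_sq]
    requires. *)
Lemma pow_vec_lt (I : finType) (x : {ffun I -> 'I_X}) j :
  (pow_vec x j <= #|I| * X ^ k)%N.
Proof.
rewrite /pow_vec -sum_nat_const; apply: leq_sum => i _.
apply: (@leq_trans (X ^ j.+1)); first by rewrite leq_exp2r // ltnW.
by rewrite leq_pexp2l // expn_gt0 p_gt0.
Qed.

Definition class_sum (b e : nat) (al : Om) : algC :=
  \sum_(x : 'I_X | x == e %[mod p ^ b]) echar z al (fun j : 'I_k => (x : nat) ^ j.+1)%N.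

(* Locked so that side conditions [0 <= class_sq _ _ _ ^+ m] are not unfolded. *)
Definition class_sq b e al : algR := locked (sqn (class_sum b e al)).

Lemma class_sqE b e al : class_sq b e al = sqn (class_sum b e al).
Proof. by rewrite /class_sq -lock. Qed.


Lemma class_sq_ge0 b e al : 0 <= class_sq b e al.
Proof. by rewrite class_sqE sqn_ge0. Qed.

Definition class_fam (I : finType) (b : I -> nat) (e : I -> nat) : {set {ffun I -> 'I_X}} :=
  [set x : {ffun I -> 'I_X} | [forall i, x i == e i %[mod p ^ b i]]].

Lemma prod_class_sum (I : finType) (b e : I -> nat) al :
  \prod_i class_sum (b i) (e i) al =
  tsum z (class_fam b e) (@pow_vec I) al.
Proof.
rewrite /class_sum bigA_distr_big_dep /tsum; apply: eq_big => [x|x _].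
  by rewrite [in RHS]inE; apply/familyP/forallP => xe i; have := xe i; rewrite unfold_in.
by rewrite /pow_vec echar_sum.
Qed.

Lemma class_sq_prod (I : finType) (b e : I -> nat) al :
  \prod_i class_sq (b i) (e i) al =
  sqn (tsum z (class_fam b e) (@pow_vec I) al).
Proof.
rewrite -prod_class_sum sqn_prod; apply: eq_bigr => i _; exact: class_sqE.
Qed.

Lemma class_sum_split b m e al :
  class_sum b e al = \sum_(c < p ^ m) class_sum (b + m) (e %% p ^ b + c * p ^ b) al.
Proof.
have pb : (0 < p ^ b)%N by rewrite expn_gt0 p_gt0.
have pm : (0 < p ^ m)%N by rewrite expn_gt0 p_gt0.
have small (u c : nat) : (c < p ^ m)%N -> (u %% p ^ b + c * p ^ b < p ^ (b + m))%N.
  move=> cm; rewrite expnD; apply: (@leq_trans (p ^ b + c * p ^ b)).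
    by rewrite ltn_add2r ltn_pmod.
  by rewrite -mulSn mulnC leq_mul2l cm orbT.
pose dig (x : nat) : 'I_(p ^ m) := Ordinal (ltn_pmod (x %/ p ^ b) pm).
rewrite /class_sum (partition_big (fun x : 'I_X => dig x) predT) //=.
apply: eq_bigr => c _; apply: eq_bigl => x.
rewrite (modn_small (small _ _ (ltn_ord c))).
have xE : (x %% p ^ (b + m) = x %% p ^ b + (x %/ p ^ b %% p ^ m) * p ^ b)%N.
  rewrite -(modn_small (small _ _ (ltn_pmod _ pm))).
  rewrite {1}(divn_eq x (p ^ b)) {1}(divn_eq (x %/ p ^ b) (p ^ m)) mulnDl -mulnA.
  by rewrite -expnD [(m + b)%N]addnC -addnA modnMDl addnC.
rewrite xE; apply/andP/eqP => [[/eqP -> /eqP <-] //|e1].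
have e2 := congr1 (modn^~ (p ^ b)%N) e1.
rewrite /= ![(_ %% _ + _)%N]addnC !modnMDl !modn_mod in e2.
by move: e1; rewrite e2 => /addnI/eqP; rewrite eqn_pmul2r.
Qed.

(** Writing x = p^b y + r, solutions inside one class become solutions in [0, p^(n-b)) by affine
    invariance. *)
Lemma avg_class_sq_le t b e : (t <= k * k.+1)%N -> (b <= n)%N ->
  avg (fun al => class_sq b e al ^+ t) <= (vino k t (p ^ (n - b)))%:R :> algR.
Proof.
move=> tk bn.
have E al : class_sq b e al ^+ t =
   sqn (tsum z (class_fam (fun _ : 'I_t => b) (fun=> e)) (@pow_vec _) al).
  by rewrite -class_sq_prod prodr_const card_ord.
rewrite (eq_avg E) mean_sq //; last first.
  move=> x j _; apply: leq_ltn_trans (pow_vec_lt _ _) _.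
  by apply: leq_ltn_trans N_big; rewrite card_ord leq_mul2r tk orbT.
have lt (x : 'I_X) : (x %/ p ^ b < p ^ (n - b))%N.
  by rewrite ltn_divLR ?expn_gt0 ?p_gt0 // -expnD subnK.
pose h (x : {ffun 'I_t -> 'I_X}) : {ffun 'I_t -> 'I_(p ^ (n - b))} := [ffun i => Ordinal (lt (x i))].
pose r := (e %% p ^ b)%N.
have xE (x : {ffun 'I_t -> 'I_X}) i : x \in class_fam (fun _ : 'I_t => b) (fun=> e) ->
   (x i = p ^ b * h x i + r :> nat)%N.
  rewrite inE => /forallP/(_ i)/eqP xe; rewrite ffunE /= /r -xe mulnC; exact: divn_eq.
rewrite ler_nat -(@card_in_imset _ _ (fun xy => (h xy.1, h xy.2))); last first.
  move=> [x y] [x' y']; rewrite !inE /= => /and3P[xA yA _] /and3P[x'A y'A _] [hx hy].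
  by congr (_, _); apply/ffunP => i; apply: val_inj => /=; rewrite !xE ?hx ?hy ?inE.
apply/subset_leq_card/subsetP => _ /imsetP[[x y]] + ->.
rewrite inE /= => /and3P[xA yA /forallP xy]; rewrite inE /=; apply/forallP => j.
apply/eqP; apply: (@affine_power_sums_inj _ k (p ^ b) r) => //; first by rewrite expn_gt0 p_gt0.
move=> [|l] //= lk; have /eqP := xy (Ordinal lk); rewrite /pow_vec /=.
by under eq_bigr do rewrite xE //; under [RHS]eq_bigr do rewrite xE //.
Qed.

Lemma avg_class_sq0 t : (t <= k * k.+1)%N ->
  avg (fun al => class_sq 0 0 al ^+ t) = (vino k t X)%:R.
Proof.
move=> tk.
have E al : class_sq 0 0 al ^+ t =
   sqn (tsum z (class_fam (fun _ : 'I_t => 0) (fun=> 0))%N (@pow_vec _) al).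
  by rewrite -class_sq_prod prodr_const card_ord.
rewrite (eq_avg E) mean_sq //; last first.
  move=> x j _; apply: leq_ltn_trans (pow_vec_lt _ _) _.
  by apply: leq_ltn_trans N_big; rewrite card_ord leq_mul2r tk orbT.
congr (_%:R); apply: eq_card => -[x y]; rewrite !inE /=.
have all0 (u : {ffun 'I_t -> 'I_X}) : [forall i, u i == 0 %[mod p ^ 0]]%N.
  by apply/forallP => i; rewrite expn0 !modn1.
by rewrite !all0.
Qed.



Notation J m := (vino k (k * k.+1) (p ^ m)).
Notation adm := (adm p).

(** The mixed means I_{a,b} and K_{a,b} of efficient congruencing; both have k + k^2 = k(k+1)
    variables on each side. *)
Definition mixed a b (xi : 'I_k -> nat) e : algR :=
  avg (fun al => (\prod_i class_sq a.+1 (xi i) al) * class_sq b e al ^+ (k * k)).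

Definition cond_mixed a b (xi ze : 'I_k -> nat) : algR :=
  avg (fun al => (\prod_i class_sq a.+1 (xi i) al) * \prod_j class_sq b.+1 (ze j) al ^+ k).

Lemma prod_class_sq_ge0 (I : finType) (b e : I -> nat) al :
  0 <= \prod_i class_sq (b i) (e i) al.
Proof. by rewrite prodr_ge0 // => i _; apply: class_sq_ge0. Qed.

Lemma mixed_ge0 a b xi e : 0 <= mixed a b xi e.
Proof.
apply: avg_ge0 => al; rewrite mulr_ge0 ?prod_class_sq_ge0 //.
by rewrite exprn_ge0 // class_sq_ge0.
Qed.

Lemma cond_mixed_ge0 a b xi ze : 0 <= cond_mixed a b xi ze.
Proof.
apply: avg_ge0 => al; rewrite mulr_ge0 ?prod_class_sq_ge0 // prodr_ge0 // => j _.
by rewrite exprn_ge0 // class_sq_ge0.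
Qed.

Definition lift_class b e (d : {ffun 'I_k -> 'I_p}) (j : 'I_k) := (e %% p ^ b + d j * p ^ b)%N.

Lemma adm_lift_class b e (d : {ffun 'I_k -> 'I_p}) : injective d -> adm b (lift_class b e d).
Proof.
have pb : (0 < p ^ b)%N by rewrite expn_gt0 p_gt0.
move=> di; split=> i i'; rewrite /lift_class.
  by rewrite ![(_ %% _ + _)%N]addnC !modnMDl.
have small j : (e %% p ^ b + d j * p ^ b < p ^ b.+1)%N.
  rewrite expnS; apply: (@leq_trans (p ^ b + d j * p ^ b)); first by rewrite ltn_add2r ltn_pmod.
  by rewrite -mulSn leq_mul2r ltn_ord orbT.
rewrite !(modn_small (small _)) => /addnI/eqP; rewrite eqn_pmul2r // => /eqP e1.
by apply: di; apply: val_inj.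
Qed.

Definition narrow_cst u : algR := k%:R ^+ (2 * (k * u)).
Definition broad_cst u : algR := p%:R ^+ (4 * (k * u)).

Lemma class_sq_broad_narrow u b e al :
  class_sq b e al ^+ (k * u) <=
   narrow_cst u * (\sum_(c < p) class_sq b.+1 (e %% p ^ b + c * p ^ b) al ^+ (k * u)) +
   broad_cst u * (\sum_(d : {ffun 'I_k -> 'I_p} | injectiveb d)
      \prod_j class_sq b.+1 (lift_class b e d j) al ^+ u).
Proof.
rewrite [in leLHS]class_sqE (class_sum_split b 1 e al) addn1.
apply: le_trans (broad_narrow u (fun c : 'I_p => class_sum b.+1 (e %% p ^ b + c * p ^ b) al) p_gt0 k_gt0) _.
rewrite le_eqVlt; apply/orP; left; apply/eqP; congr (_ * _ + _ * _).
  by apply: eq_bigr => c _; rewrite class_sqE.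
by apply: eq_bigr => d _; apply: eq_bigr => j _; rewrite class_sqE.
Qed.

Lemma sum_injective_le (F : {ffun 'I_k -> 'I_p} -> algR) (W : algR) :
  0 <= W -> (forall d : {ffun 'I_k -> 'I_p}, injective d -> F d <= W) ->
  \sum_(d : {ffun 'I_k -> 'I_p} | injectiveb d) F d <= p%:R ^+ k * W.
Proof.
move=> W0 FW; apply: (@le_trans _ _ (\sum_(d : {ffun 'I_k -> 'I_p}) W)).
  rewrite [leRHS](bigID (fun d : {ffun 'I_k -> 'I_p} => injectiveb d)) /= ler_wpDr ?sumr_ge0 //.
  by apply: ler_sum => d /injectiveP; apply: FW.
by rewrite sumr_const card_ffun !card_ord -[leLHS]mulr_natl natrX.
Qed.

(** Splits the class modulo [p ^ b] by its next digit: either one subclass dominates, or [k]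
    distinct digits occur and the tuple is conditioned. *)
Lemma mixed_broad_narrow a b xi e (W1 W2 : algR) : 0 <= W2 ->
  (forall e', mixed a b.+1 xi e' <= W1) ->
  (forall ze, adm b ze -> cond_mixed a b xi ze <= W2) ->
  mixed a b xi e <= narrow_cst k * p%:R * W1 + broad_cst k * p%:R ^+ k * W2.
Proof.
move=> W20 h1 h2; rewrite /mixed.
have pt al := ler_wpM2l (prod_class_sq_ge0 (fun=> a.+1) xi al) (class_sq_broad_narrow k b e al).
apply: le_trans (avg_le pt) _.
pose P al := \prod_i class_sq a.+1 (xi i) al.
rewrite (@eq_avg _ _ (fun al =>
  narrow_cst k * (\sum_(c < p) P al * class_sq b.+1 (e %% p ^ b + c * p ^ b) al ^+ (k * k)) +
  broad_cst k * (\sum_(d : {ffun 'I_k -> 'I_p} | injectiveb d)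
      P al * \prod_j class_sq b.+1 (lift_class b e d j) al ^+ k))); last first.
  by move=> al; rewrite mulrDr [P al]lock -!mulr_sumr -lock; congr (_ + _); rewrite mulrCA.
rewrite avgD !avgZ !avg_sum; apply: lerD.
  rewrite -mulrA ler_wpM2l ?exprn_ge0 ?ler0n //.
  apply: (@le_trans _ _ (\sum_(c < p) W1)).
    by apply: ler_sum => c _; apply: (h1 (e %% p ^ b + c * p ^ b)%N).
  by rewrite sumr_const card_ord mulr_natl.
rewrite -mulrA ler_wpM2l ?exprn_ge0 ?ler0n //.
apply: sum_injective_le => // d di; apply: h2; exact: adm_lift_class.
Qed.

Lemma avg_prod_class_sq b ze u : (u <= k.+1)%N -> (b <= n)%N ->
  avg (fun al => \prod_(j < k) class_sq b (ze j) al ^+ u) <= (vino k (k * u) (p ^ (n - b)))%:R :> algR.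
Proof.
move=> uk bn; rewrite -(ler_pXn2r k_gt0) ?nnegrE ?ler0n //; last first.
  by apply: avg_ge0 => al; rewrite prodr_ge0 // => j _; rewrite exprn_ge0 ?class_sq_ge0.
apply: le_trans (holder_prod k_gt0 _) _; first by move=> j al; rewrite exprn_ge0 ?class_sq_ge0.
pose Q : algR := (vino k (k * u) (p ^ (n - b)))%:R.
rewrite -/Q; have <- : \prod_(j < k) Q = Q ^+ k by rewrite prodr_const card_ord.
apply: ler_prod => j _; apply/andP; split.
  by apply: avg_ge0 => al; do 2 apply: exprn_ge0; apply: class_sq_ge0.
have ku : (k * u <= k * k.+1)%N by rewrite leq_mul2l uk orbT.
apply: le_trans (@avg_class_sq_le (k * u) b (ze j) ku bn).
by rewrite le_eqVlt; apply/orP; left; apply/eqP/eq_avg => al; rewrite -exprM mulnC.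
Qed.

(** The integrand is the geometric mean over [i] of [g i ^+ k * G], so a common bound for these
    passes to it. The power [r] accommodates bounds known only for integer powers. *)
Lemma holder_distribute (g : 'I_k -> Om -> algR) (G : Om -> algR) (Y : algR) r :
  (0 < r)%N -> 0 <= Y -> (forall i al, 0 <= g i al) -> (forall al, 0 <= G al) ->
  (forall i, avg (fun al => g i al ^+ k * G al) ^+ r <= Y) ->
  avg (fun al => (\prod_i g i al) * G al) ^+ r <= Y.
Proof.
move=> r0 Y0 g0 G0 H.
have h0 : 0 <= avg (fun al => (\prod_i g i al) * G al).
  by apply: avg_ge0 => al; rewrite mulr_ge0 // prodr_ge0.
rewrite -(ler_pXn2r k_gt0) ?nnegrE ?exprn_ge0 // exprAC.
have := @holder _ 'I_k (fun i al => g i al ^+ k * G al) (fun al => (\prod_i g i al) * G al).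
rewrite card_ord => /(_ k_gt0) hold.
apply: (@le_trans _ _ ((\prod_(i < k) avg (fun al => g i al ^+ k * G al)) ^+ r)).
  apply: lerXn2r; rewrite ?nnegrE ?exprn_ge0 //.
    by rewrite prodr_ge0 // => i _; apply: avg_ge0 => al; rewrite mulr_ge0 ?exprn_ge0.
  apply: hold => [i al|al|al]; rewrite ?mulr_ge0 ?exprn_ge0 ?prodr_ge0 //.
  by rewrite exprMn big_split /= prodrXl prodr_const card_ord.
rewrite -prodrXl -[in leRHS](card_ord k) -prodr_const.
apply: ler_prod => i _; rewrite H andbT exprn_ge0 // avg_ge0 // => al.
by rewrite mulr_ge0 ?exprn_ge0.
Qed.

(** Hölder with weights 1 and [k] separates the two levels; the power [k.+1] avoids roots. *)
Lemma mixed_base a b xi e : (a < n)%N -> (b <= n)%N ->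
  mixed a b xi e ^+ k.+1 <= (J (n - a.+1))%:R * (J (n - b))%:R ^+ k :> algR.
Proof.
move=> an bn; apply: holder_distribute => //; rewrite ?mulr_ge0 ?exprn_ge0 ?ler0n //.
- by move=> i al; apply: class_sq_ge0.
- by move=> al; rewrite exprn_ge0 ?class_sq_ge0.
move=> i; rewrite -[k.+1]add1n.
apply: (@le_trans _ _ (avg (fun al => class_sq a.+1 (xi i) al ^+ (k * k.+1)) ^+ 1 *
    avg (fun al => class_sq b e al ^+ (k * k.+1)) ^+ k)).
  apply: holder2 => // al; rewrite ?mulr_ge0 ?exprn_ge0 ?class_sq_ge0 //.
  by rewrite expr1 exprMn -!exprM add1n; congr (_ * _ ^+ _); lia.
rewrite expr1 ler_pM ?exprn_ge0 ?avg_ge0 //; try by move=> al; rewrite exprn_ge0 ?class_sq_ge0.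
  exact: avg_class_sq_le.
apply: lerXn2r; rewrite ?nnegrE ?ler0n ?avg_ge0 //; last exact: avg_class_sq_le.
by move=> al; rewrite exprn_ge0 ?class_sq_ge0.
Qed.

(* The congruences modulo [p ^ (j b)] forced by the classes [ze] confine the
   [k] conditioned variables, up to the classes they already occupy, to few
   classes modulo [p ^ (k b)]. *)
Lemma cond_mixed_refine a b (xi ze : 'I_k -> nat) (W : algR) :
  (a < b)%N -> adm a xi -> adm b ze -> 0 <= W ->
  (forall c : {ffun 'I_k -> 'I_(p ^ (k * b))},
     avg (fun al => (\prod_i class_sq (k * b) (c i) al) * \prod_j class_sq b.+1 (ze j) al ^+ k) <= W) ->
  cond_mixed a b xi ze <= p%:R ^+ ('C(k, 2) * (a + b) + k * (k * b - a.+1)) * W.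
Proof.
move=> ab axi aze W0 HW.
have akb : (a.+1 <= k * b)%N by apply: leq_trans ab _; rewrite leq_pmull.
pose A := class_fam (fun=> a.+1) xi.
pose B := class_fam (fun=> b.+1) (fun i : 'I_k * 'I_k => ze i.1).
have BE (al : Om) : \prod_j class_sq b.+1 (ze j) al ^+ k = sqn (tsum z B (@pow_vec _) al).
  rewrite -class_sq_prod -(pair_bigA _ (fun i j : 'I_k => class_sq b.+1 (ze i) al)) /=.
  by apply: eq_bigr => j _; rewrite prodr_const card_ord.
have -> : cond_mixed a b xi ze = avg (fun al : Om => sqn (tsum z A (@pow_vec _) al) * sqn (tsum z B (@pow_vec _) al)).
  by apply: eq_avg => al; rewrite BE; congr (_ * _); apply: class_sq_prod.
have pkb : (0 < p ^ (k * b))%N by rewrite expn_gt0 p_gt0.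
pose cell (x : {ffun 'I_k -> 'I_X}) : {ffun 'I_k -> 'I_(p ^ (k * b))} :=
  [ffun i => Ordinal (ltn_pmod (x i) pkb)].
pose e := (ze (Ordinal k_gt0) %% p ^ b)%N.
(* Adding [c0] moves the common class of all [ze j] modulo [p ^ b] to 0. *)
pose c0 := (p ^ b - e)%N.
have ec0 : (e + c0 = p ^ b)%N by rewrite /c0 subnKC // ltnW // ltn_pmod // expn_gt0 p_gt0.
have lab_lt (c : {ffun 'I_k -> 'I_(p ^ (k * b))}) (j : 'I_k) :
    ((\sum_i (c i + c0) ^ j.+1) %% p ^ (j.+1 * b) < p ^ (k * b))%N.
  apply: (@leq_trans (p ^ (j.+1 * b))); first by rewrite ltn_pmod // expn_gt0 p_gt0.
  by rewrite leq_pexp2l // leq_mul2r ltn_ord orbT.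
pose lab (c : {ffun 'I_k -> 'I_(p ^ (k * b))}) : {ffun 'I_k -> 'I_(p ^ (k * b))} :=
  [ffun j => Ordinal (lab_lt c j)].
pose D := [set c : {ffun 'I_k -> 'I_(p ^ (k * b))} | [forall i, c i == xi i %[mod p ^ a.+1]]].
have cell_mod (x : {ffun 'I_k -> 'I_X}) i d : (d <= k * b)%N -> cell x i = x i %[mod p ^ d].
  by move=> dk; rewrite ffunE /= modn_dvdm // dvdn_exp2l.
apply: le_trans (@mean_split k N z N_gt0 prim_z _ _ _ _ A B (@pow_vec _) (@pow_vec _)
   cell lab D (p ^ ('C(k, 2) * (a + b))) _ _ _ _) _.
- move=> x y j _ _; apply: (@leq_ltn_trans (k * k.+1 * X ^ k)%N) => //.
  apply: leq_trans (leq_add (pow_vec_lt x j) (pow_vec_lt y j)) _.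
  by rewrite card_prod !card_ord -mulnDl mulnS.
- move=> x; rewrite !inE => /forallP xA; apply/forallP => i.
  by rewrite cell_mod.
- move=> x x' y y' _ _ yB y'B xy; apply/ffunP => j; apply: val_inj; rewrite !ffunE /=.
  have eqS (u : {ffun 'I_k -> 'I_X}) : (\sum_i (cell u i + c0) ^ j.+1 =
      \sum_i (u i + c0) ^ j.+1 %[mod p ^ (j.+1 * b)])%N.
    apply: (big_ind2 (fun s t => s = t %[mod p ^ (j.+1 * b)])%N) => //.
      by move=> s1 t1 s2 t2 h1 h2; rewrite -modnDm h1 h2 modnDm.
    move=> i _; rewrite -modnXm -modnDml cell_mod; last by rewrite leq_mul2r ltn_ord orbT.
    by rewrite modnDml modnXm.
  rewrite !eqS.
  (* Each shifted variable is divisible by [p ^ b], so this block disappears from the degree [j.+1]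
     equation modulo [p ^ (j.+1 * b)] and the label depends on [x] alone. *)
  have y0 (u : {ffun 'I_k * 'I_k -> 'I_X}) : u \in B ->
     (\sum_i (u i + c0) ^ j.+1 = 0 %[mod p ^ (j.+1 * b)])%N.
    move=> uB; apply/eqP; rewrite mod0n; apply: dvdn_sum => i _.
    rewrite mulnC expnM dvdn_exp2r // /dvdn -modnDml.
    move: uB; rewrite inE => /forallP/(_ i)/eqP ui.
    have -> : (u i %% p ^ b = e)%N.
      rewrite /e -(aze.1 i.1); have := congr1 (modn^~ (p ^ b)%N) ui.
      by rewrite /= !modn_dvdm // dvdn_exp2l.
    by rewrite ec0 modnn.
  have sh := @shift_power_sums _ _ k c0 (fun i => x i) (fun i => x' i) (fun i => y i) (fun i => y' i).
  have {}sh : (\sum_i (x i + c0) ^ j.+1 + \sum_i (y i + c0) ^ j.+1 =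
      \sum_i (x' i + c0) ^ j.+1 + \sum_i (y' i + c0) ^ j.+1)%N.
    by apply: sh; [move=> [|l] //= lk; apply: (xy (Ordinal lk))|rewrite /= ltn_ord].
  have := congr1 (modn^~ (p ^ (j.+1 * b))%N) sh.
  by rewrite /= -modnDmr (y0 _ yB) modnDmr addn0 -[in RHS]modnDmr (y0 _ y'B) modnDmr addn0.
- move=> l; apply: leq_trans (@card_congr_set p k p_pr kp a b c0 xi (fun j => l j) k_gt0 ab axi).
  apply/subset_leq_card/subsetP => c; rewrite !inE => /andP[-> /eqP lE] /=.
  apply/forallP => j; rewrite -lE ffunE /= modn_mod; exact: eqxx.
rewrite exprD natrX -mulrA ler_wpM2l ?exprn_ge0 ?ler0n //.
apply: (@le_trans _ _ (\sum_(c in D) W)).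
  apply: ler_sum => c cD; apply: le_trans (HW c); rewrite le_eqVlt; apply/orP; left; apply/eqP.
  apply: eq_avg => al; rewrite BE; congr (_ * _); rewrite (class_sq_prod (fun=> (k * b)%N) (fun i => c i)).
  congr (sqn (tsum _ _ _ _)); apply/setP => x; rewrite !inE.
  apply/andP/forallP => [[_ /eqP <-] i|xc]; first by rewrite cell_mod.
  have cx : cell x = c.
    apply/ffunP => i; apply: val_inj; have := xc i.
    by rewrite ffunE /= [in X in _ == X]modn_small // => /eqP.
  split; last by rewrite cx.
  apply/forallP => i; move: cD; rewrite inE -cx => /forallP/(_ i).
  by rewrite cell_mod.
(* Each of the [k] coordinates of a cell in [D] is fixed modulo [p ^ a.+1], which leaves p^(kb-a-1)
   choices. *)
rewrite sumr_const -[leLHS]mulr_natl ler_wpM2r // -natrX ler_nat.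
pose F i := [set c : 'I_(p ^ (k * b)) | c == xi i %[mod p ^ a.+1]].
apply: (@leq_trans #|family (fun i => mem (F i))|).
  apply/subset_leq_card/subsetP => c; rewrite inE => /forallP cD; apply/familyP => i.
  by rewrite inE.
rewrite card_family foldrE big_map big_enum /=.
apply: (@leq_trans (\prod_(i < k) p ^ (k * b - a.+1))%N).
  by apply: leq_prod => i _; apply: card_residue_class.
by rewrite prod_nat_const card_ord -expnM mulnC.
Qed.

(** After refinement the two blocks change roles. Hölder with weights 1 and [k.-1] keeps one copy of
    the level [b] block next to [k * k] variables modulo [p ^ (k * b)]; the surplus copies are
    bounded by [J]. *)
Lemma efficient_congruencing a b (xi ze : 'I_k -> nat) (V : algR) :
  (a < b)%N -> (b < n)%N -> adm a xi -> adm b ze -> 0 <= V ->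
  (forall e, mixed b (k * b) ze e <= V) ->
  cond_mixed a b xi ze ^+ k <=
    (p%:R ^+ ('C(k, 2) * (a + b) + k * (k * b - a.+1))) ^+ k *
    (V * (J (n - b.+1))%:R ^+ k.-1).
Proof.
move=> ab bn axi aze V0 HV.
pose Y : algR := V * (J (n - b.+1))%:R ^+ k.-1.
have Y0 : 0 <= Y by rewrite mulr_ge0 ?exprn_ge0 ?ler0n.
(* [cond_mixed_refine] is linear in its bound, so a [k]-th root of [Y] is needed. *)
have [w w0 wY] := algR_root Y0 k_gt0.
rewrite -/Y -wY -exprMn; apply: lerXn2r.
- by rewrite nnegrE cond_mixed_ge0.
- by rewrite nnegrE mulr_ge0 ?exprn_ge0 ?ler0n.
apply: cond_mixed_refine => // c.
have F0 al : 0 <= \prod_j class_sq b.+1 (ze j) al := prod_class_sq_ge0 (fun=> b.+1) ze al.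
have G0 al : 0 <= \prod_j class_sq b.+1 (ze j) al ^+ k.
  by rewrite prodr_ge0 // => j _; rewrite exprn_ge0 ?class_sq_ge0.
rewrite -(ler_pXn2r k_gt0) ?nnegrE // ?wY; last first.
  by apply: avg_ge0 => al; rewrite mulr_ge0 // (prod_class_sq_ge0 (fun=> _) (fun i => c i)).
apply: holder_distribute => // [i al|i]; first exact: class_sq_ge0.
have kE : k = (1 + k.-1)%N by rewrite add1n prednK.
apply: (@le_trans _ _ (avg (fun al => (\prod_j class_sq b.+1 (ze j) al) * class_sq (k * b) (c i) al ^+ (k * k)) ^+ 1
   * avg (fun al => \prod_j class_sq b.+1 (ze j) al ^+ k.+1) ^+ k.-1)).
  rewrite [X in _ ^+ X <= _]kE; apply: holder2 => // al.
  - by rewrite mulr_ge0 ?exprn_ge0 ?class_sq_ge0.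
  - by rewrite prodr_ge0 // => j _; rewrite exprn_ge0 ?class_sq_ge0.
  - by rewrite mulr_ge0 ?exprn_ge0 ?class_sq_ge0.
  rewrite -kE expr1 !prodrXl exprMn -!exprM mulrC mulrAC -exprS; congr (_ ^+ _ * _).
  by rewrite mulSn addnC mulnC; case: (k) k_gt0 => // k' _ /=; lia.
rewrite expr1; apply: ler_pM => //.
- by apply: avg_ge0 => al; rewrite mulr_ge0 ?exprn_ge0 ?class_sq_ge0.
- apply/exprn_ge0/avg_ge0 => al; rewrite prodr_ge0 // => j _.
  by rewrite exprn_ge0 ?class_sq_ge0.
- exact: HV.
apply: lerXn2r; rewrite ?nnegrE ?ler0n //.
  by apply: avg_ge0 => al; rewrite prodr_ge0 // => j _; rewrite exprn_ge0 ?class_sq_ge0.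
exact: avg_prod_class_sq.
Qed.

(** Of the [k.+1] copies of each class modulo [p] one stays as the conditioned block. The other
    [k * k] factors are bounded by the largest class, which is then cut crudely into classes modulo
    [p ^ m.+1]. *)
Lemma vino_start m (V : algR) : (0 < n)%N -> 0 <= V ->
  (forall ze e, adm 0 ze -> mixed 0 m.+1 ze e <= V) ->
  (J n)%:R <= narrow_cst k.+1 * p%:R * (J (n - 1))%:R +
     broad_cst k.+1 * p%:R ^+ k * (k%:R * (p%:R ^+ (2 * m * (k * k) + m) * V)) :> algR.
Proof.
move=> n0 V0 HV; rewrite -avg_class_sq0 //.
apply: le_trans (avg_le (fun al => class_sq_broad_narrow k.+1 0 0 al)) _.
rewrite avgD !avgZ !avg_sum; apply: lerD.
  rewrite -mulrA ler_wpM2l ?exprn_ge0 ?ler0n //.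
  apply: (@le_trans _ _ (\sum_(c < p) (J (n - 1))%:R)).
    by apply: ler_sum => c _; apply: avg_class_sq_le.
  by rewrite sumr_const card_ord mulr_natl.
rewrite -mulrA ler_wpM2l ?exprn_ge0 ?ler0n //.
apply: sum_injective_le; first by rewrite !mulr_ge0 ?exprn_ge0 ?ler0n.
move=> d di; set ze := lift_class 0 0 d; have aze : adm 0 ze by apply: adm_lift_class.
pose P al := \prod_j class_sq 1 (ze j) al.
have P0 al : 0 <= P al by rewrite (prod_class_sq_ge0 (fun=> 1%N)).
pose eta j (c : 'I_(p ^ m)) := (ze j %% p ^ 1 + c * p ^ 1)%N.
have pt al : \prod_j class_sq 1 (ze j) al ^+ k.+1 <=
   \sum_(j < k) p%:R ^+ (2 * m * (k * k)) * \sum_(c < p ^ m) P al * class_sq m.+1 (eta j c) al ^+ (k * k).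
  have -> : \prod_j class_sq 1 (ze j) al ^+ k.+1 = P al * \prod_j class_sq 1 (ze j) al ^+ k.
    by rewrite /P -big_split; apply: eq_bigr => j _; rewrite exprS.
  rewrite [leRHS](eq_bigr (fun j => P al * (p%:R ^+ (2 * m * (k * k)) *
      \sum_(c < p ^ m) class_sq m.+1 (eta j c) al ^+ (k * k)))); last first.
    by move=> j _; rewrite mulrCA; congr (_ * _); rewrite mulr_sumr.
  rewrite -mulr_sumr ler_wpM2l //.
  have j0 := Ordinal k_gt0.
  have [j jm] := exists_max j0 (fun j => class_sq 1 (ze j) al).
  apply: (@le_trans _ _ (class_sq 1 (ze j) al ^+ (k * k))).
    rewrite exprM -[X in _ <= _ ^+ X](card_ord k) -prodr_const.
    apply: ler_prod => i _; rewrite exprn_ge0 ?class_sq_ge0 //=.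
    by apply: lerXn2r; rewrite ?nnegrE ?class_sq_ge0.
  rewrite (bigD1 j) //= ler_wpDr //.
    apply: sumr_ge0 => i _; rewrite mulr_ge0 ?exprn_ge0 ?ler0n // sumr_ge0 // => c _.
    by rewrite exprn_ge0 ?class_sq_ge0.
  rewrite [in leLHS]class_sqE (class_sum_split 1 m (ze j) al) add1n.
  have pm0 : (0 < #|'I_(p ^ m)|)%N by rewrite card_ord expn_gt0 p_gt0.
  apply: le_trans (sqn_sum_crude _ _ pm0) _.
  rewrite card_ord natrX -exprM mulnA [(m * 2)%N]mulnC ler_wpM2l ?exprn_ge0 ?ler0n //.
  by apply: ler_sum => c _; rewrite class_sqE.
apply: le_trans (avg_le pt) _; rewrite avg_sum.
apply: (@le_trans _ _ (\sum_(j < k) (p%:R ^+ (2 * m * (k * k) + m) * V))).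
  apply: ler_sum => j _; rewrite avgZ avg_sum exprD -mulrA.
  rewrite ler_wpM2l ?exprn_ge0 ?ler0n //.
  apply: (@le_trans _ _ (\sum_(c < p ^ m) V)).
    by apply: ler_sum => c _; apply: (HV ze (eta j c) aze).
  by rewrite sumr_const card_ord -[leLHS]mulr_natl natrX.
by rewrite sumr_const card_ord -[leLHS]mulr_natl.
Qed.

End MeanValues.

(** * The congruencing iteration *)

(* Exponents of [p] in the descent of [I_iterate], where [b = k * a + h],
   [B2 = 'C(k, 2)] and [D = 'C(k.+1, 2)]. *)
Lemma exponent_budget k a h y B2 D : (3 <= k)%N ->
  (B2 * 2 = k * k.-1)%N -> (D * 2 = k.+1 * k)%N -> (y + a.+1 = k * (k * a + h))%N ->
  (k * (3 * h + k * k * k * a) + k * (B2 * (a + (k * a + h)) + k * y) <=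
     3 * D * (k * a + h) * k.-1 + k * k * k * (k * a + h))%N.
Proof.
move=> k3 eB eD ey; rewrite -(leq_pmul2r (isT : 0 < 2)%N).
have [u kE] : exists u, k = u.+3 by exists (k - 3)%N; lia.
(* Twice the slack of the inequality; with u = k - 3 all its coefficients are natural numbers, so a
   polynomial identity remains. *)
pose ext := (h * (k * u) + 2 * k * (u * u + 6 * u + 6) * h + 2 * k * k)%N.
have e1 : (k * (k * y) * 2 + k * k * 2 * a.+1 = k * k * 2 * (k * (k * a + h)))%N.
  by rewrite -ey; lia.
have e2 : (k * (B2 * (a + (k * a + h))) * 2 = k * (k * k.-1) * (a + (k * a + h)))%N.
  by rewrite -eB; lia.
have e3 : (3 * D * (k * a + h) * k.-1 * 2 = 3 * (k.+1 * k) * (k * a + h) * k.-1)%N.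
  by rewrite -eD; lia.
suff : (3 * (k.+1 * k) * (k * a + h) * k.-1 + k * k * k * (k * a + h) * 2 + k * k * 2 * a.+1 =
   k * (3 * h + k * k * k * a) * 2 + k * (k * k.-1) * (a + (k * a + h)) +
   k * k * 2 * (k * (k * a + h)) + ext)%N by move: ext => ext; lia.
by rewrite /ext kE /=; lia.
Qed.

(** The same budget for the opening comparison in [not_record], from level 0 to modulus exponent
    [b + h]. *)
Lemma exponent_budget0 k b h y B2 D : (3 <= k)%N ->
  (B2 * 2 = k * k.-1)%N -> (D * 2 = k.+1 * k)%N -> (y + 1 = k * (b + h))%N ->
  (k * (3 * h + 3 * (k * k) * b) + k * (B2 * (0 + (b + h)) + k * y) <=
     3 * D * (b + h) * k.-1 + 3 * (k * k * k) * (b + h))%N.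
Proof.
move=> k3 eB eD ey; rewrite -(leq_pmul2r (isT : 0 < 2)%N).
have [u kE] : exists u, k = u.+3 by exists (k - 3)%N; lia.
pose ext := ((b + h) * (k * u) + 6 * k * (u * u + 6 * u + 8) * h + 2 * k * k)%N.
have e1 : (k * (k * y) * 2 + k * k * 2 = k * k * 2 * (k * (b + h)))%N.
  by rewrite -ey; lia.
have e2 : (k * (B2 * (0 + (b + h))) * 2 = k * (k * k.-1) * (b + h))%N.
  by rewrite -eB; lia.
have e3 : (3 * D * (b + h) * k.-1 * 2 = 3 * (k.+1 * k) * (b + h) * k.-1)%N.
  by rewrite -eD; lia.
suff : (3 * (k.+1 * k) * (b + h) * k.-1 + 3 * (k * k * k) * (b + h) * 2 + k * k * 2 =
   k * (3 * h + 3 * (k * k) * b) * 2 + k * (k * k.-1) * (b + h) +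
   k * k * 2 * (k * (b + h)) + ext)%N by move: ext => ext; lia.
by rewrite /ext kE /=; lia.
Qed.

(** * Numerical ranges for the iteration *)

Lemma range_base k a n : (3 <= k)%N -> (0 < a)%N -> ((7 * k) ^ (0 + 2) * a <= n)%N ->
  (a < n)%N /\ (k * a <= n)%N.
Proof.
rewrite add0n expnS expn1 => k3 a0 h.
have : (k * a * 7 * (7 * k) <= n)%N by apply: leq_trans h; lia.
have : (3 * a <= k * a)%N by rewrite leq_mul2r k3 orbT.
have : (k * a * 7 * 3 <= k * a * 7 * (7 * k))%N by rewrite leq_mul2l; lia.
lia.
Qed.

(** A comparison replaces [a] by some k a + h with h < 6ka, so below 7ka; the factor [7 * k] per
    step reserves this room. *)
Lemma range_step k a n i : (3 <= k)%N -> (0 < a)%N -> ((7 * k) ^ (i.+1 + 2) * a <= n)%N ->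
  [/\ (a < n)%N, (k * a + 6 * (k * a) < n)%N & ((7 * k) ^ (i + 2) * (k * a + 6 * (k * a)) <= n)%N].
Proof.
move=> k3 a0; rewrite addSn expnS.
have e : (7 * k * (7 * k) ^ (i + 2) * a = (7 * k) ^ (i + 2) * (k * a + 6 * (k * a)))%N.
  by move: ((7 * k) ^ _)%N => z; lia.
rewrite e => h; split=> //.
  have : (1 < (7 * k) ^ (i + 2))%N by rewrite -(expn0 (7 * k)%N) ltn_exp2l ?addn2 //; lia.
  have : (3 * a <= k * a)%N by rewrite leq_mul2r k3 orbT.
  move: h; move: ((7 * k) ^ _)%N => z h h1 h2.
  have : (2 * (k * a + 6 * (k * a)) <= n)%N by apply: leq_trans h; rewrite leq_mul2r h2 orbT.
  lia.
have h2 : (1 < (7 * k) ^ (i + 2))%N by rewrite -(expn0 (7 * k)%N) ltn_exp2l ?addn2 //; lia.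
have : (2 * (k * a + 6 * (k * a)) <= n)%N by apply: leq_trans h; rewrite leq_mul2r h2 orbT.
have : (0 < k * a)%N by rewrite muln_gt0 a0 andbT; lia.
lia.
Qed.

Lemma range_class k a h i : (3 <= k)%N -> (0 < a)%N -> (h < 6 * (k * a))%N ->
  [/\ (a < k * a + h)%N, (k * a + h < k * a + 6 * (k * a))%N, (0 < k * a + h)%N,
   (k * (k * a + h) - a.+1 + a.+1 = k * (k * a + h))%N &
   (k * (i.+1 * a) <= i * (k * a + h) + (k * a + h) * k.-1)%N].
Proof.
move=> k3 a0 hh.
have ka : (3 * a <= k * a)%N by rewrite leq_mul2r k3 orbT.
split; try lia.
  have : (1 * (k * a + h) <= k * (k * a + h))%N by rewrite leq_mul2r; lia.
  lia.
have : (2 * (k * a + h) <= k.-1 * (k * a + h))%N by rewrite leq_mul2r; lia.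
lia.
Qed.

(** The reason for descending up to 7ka: there the trivial exponent 7k^3 a covers 18ka + 5k^3 a,
    because k^2 >= 9. *)
Lemma range_exponent k a : (3 <= k)%N ->
  (3 * (6 * (k * a)) + (k * k * k * a + 4 * (k * k * k) * a) <= k * k * (k * a + 6 * (k * a)))%N.
Proof.
move=> k3; have : (9 * (k * a) <= k * k * (k * a))%N.
  by rewrite leq_mul2r (leq_mul k3 k3) orbT.
lia.
Qed.

Lemma range_final k b n z : (3 <= k)%N -> (0 < b)%N -> ((7 * k) ^ (z + 2) * (4 * b) <= n)%N ->
  (0 < n)%N /\ (b + 3 * b < n)%N.
Proof.
move=> k3 b0 h.
have h2 : (1 < (7 * k) ^ (z + 2))%N by rewrite -(expn0 (7 * k)%N) ltn_exp2l ?addn2 //; lia.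
have : (2 * (4 * b) <= n)%N by apply: leq_trans h; rewrite leq_mul2r h2 orbT.
lia.
Qed.

Lemma range_class0 k b h : (3 <= k)%N -> (0 < b)%N -> (h < 3 * b)%N ->
  [/\ (0 < b + h)%N, (b + h <= b + 3 * b)%N, (b + h <= 4 * b)%N &
      (k * (b + h) - 1 + 1 = k * (b + h))%N].
Proof.
by move=> k3 b0 hh; split; lia.
Qed.

Lemma range_exponent0 k b : (3 <= k)%N ->
  (3 * (3 * b) + 3 * (k * k) * b <= k * k * (b + 3 * b))%N.
Proof.
move=> k3; have : (9 * b <= k * k * b)%N by rewrite leq_mul2r (leq_mul k3 k3) orbT.
lia.
Qed.

Lemma range_exponent1 k b : (3 <= k)%N -> (0 < b)%N ->
  (2 * b.-1 * (k * k) + b.-1 + b <= 3 * (k * k) * b)%N.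
Proof.
move=> k3 b0; have : (9 * b <= k * k * b)%N by rewrite leq_mul2r (leq_mul k3 k3) orbT.
case: b b0 => // b _ /=; lia.
Qed.

(* An abstract form of the iteration: [J m] stands for [J_w(p ^ m)] with
   [w = k (k + 1)], [q] for the prime, [I a b] for the mean value with [k]
   variables conditioned at level [a] and [k ^ 2] variables in one class
   modulo [p ^ b], and [I' a b] for the one where the latter are conditioned
   as well. *)
Section Iteration.
Variables (R : realFieldType) (k n : nat) (q A B A' : R) (J : nat -> R).
Variable adm : nat -> ('I_k -> nat) -> Prop.
Variable I : nat -> nat -> ('I_k -> nat) -> nat -> R.
Variable I' : nat -> nat -> ('I_k -> nat) -> ('I_k -> nat) -> R.
Hypotheses (k3 : (3 <= k)%N) (q2 : 2 <= q :> R) (Aq : A <= q) (B1 : 1 <= B :> R).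
Hypotheses (J_ge0 : forall m, 0 <= J m :> R) (Jn_gt0 : 0 < J n :> R).
Hypothesis I_ge0 : forall a b xi e, 0 <= I a b xi e :> R.
Hypothesis I'_ge0 : forall a b xi ze, 0 <= I' a b xi ze :> R.
Hypothesis I_base : forall a b xi e, (a < n)%N -> (b <= n)%N ->
  I a b xi e ^+ k.+1 <= J (n - a.+1)%N * J (n - b)%N ^+ k.
Hypothesis I_broad_narrow : forall a b xi e (W1 W2 : R), 0 <= W2 ->
  (forall e', I a b.+1 xi e' <= W1) ->
  (forall ze, adm b ze -> I' a b xi ze <= W2) ->
  I a b xi e <= A * q * W1 + B * q ^+ k * W2.
Hypothesis I_congruencing : forall a b xi ze (V : R), (a < b)%N -> (b < n)%N -> adm a xi -> adm b ze ->
  0 <= V -> (forall e, I b (k * b) ze e <= V) ->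
  I' a b xi ze ^+ k <=
    (q ^+ ('C(k, 2) * (a + b) + k * (k * b - a.+1))) ^+ k * (V * J (n - b.+1)%N ^+ k.-1).

Let w : R := 2 * q ^+ (3 * 'C(k.+1, 2)).
Hypothesis J_record : forall m, (m <= n)%N -> J m * w ^+ (n - m) <= J n.

Let C : R := 2 * B * q ^+ k.

Let q0 : 0 < q :> R. Proof. exact: lt_le_trans q2. Qed.
Let q1 : 1 <= q :> R. Proof. by apply: le_trans q2; rewrite ler1n. Qed.
Let qX1 m : 1 <= q ^+ m :> R. Proof. exact: exprn_ege1. Qed.
Let qX0 m : 0 < q ^+ m :> R. Proof. exact: exprn_gt0. Qed.
Let twoX1 m : 1 <= 2 ^+ m :> R. Proof. by apply: exprn_ege1; lra. Qed.
Let twoX0 m : 0 < 2 ^+ m :> R. Proof. by apply: exprn_gt0; lra. Qed.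
Let B0 : 0 <= B :> R. Proof. exact: le_trans B1. Qed.
Let qge : 0 <= q :> R. Proof. exact: ltW. Qed.
Let twoge : 0 <= 2 :> R. Proof. by []. Qed.
Let qX m : 0 <= q ^+ m :> R. Proof. exact: ltW. Qed.
Let twoX m : 0 <= 2 ^+ m :> R. Proof. exact: ltW. Qed.
Let Jn : 0 <= J n :> R. Proof. exact: ltW. Qed.
Let C1 : 1 <= C :> R.
Proof.
rewrite /C; apply: mulr_ege1 => //; apply: mulr_ege1 => //; lra.
Qed.
Let w0 : 0 < w :> R. Proof. by rewrite mulr_gt0 //; lra. Qed.
Let w1 : 1 <= w :> R. Proof. by rewrite mulr_ege1 //; lra. Qed.
Let binE : ('C(k.+1, 2) * 2 = k.+1 * k)%N.
Proof. by rewrite mulnC -mul_bin_diag bin1. Qed.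
Let binE' : ('C(k, 2) * 2 = k * k.-1)%N.
Proof. by rewrite mulnC -mul_bin_diag bin1. Qed.

Lemma J_le m : (m <= n)%N -> J m <= J n.
Proof.
move=> mn; apply: le_trans _ (J_record mn); rewrite -[leLHS]mulr1 ler_wpM2l //.
exact: exprn_ege1.
Qed.

Lemma J_sub b : (b <= n)%N -> J (n - b)%N * w ^+ b <= J n.
Proof. by move=> bn; have := J_record (leq_subr b n); rewrite subKn. Qed.

(** In [I_base] the record property saves w^(bk), and 3C(k+1,2) >= k(k+1) makes this at least the
    (k+1)-st power of the claimed factor. *)
Lemma I_trivial a b xi e : (a < n)%N -> (b <= n)%N -> I a b xi e * q ^+ (k * k * b) <= J n.
Proof.
move=> an bn; rewrite -(@ler_pXn2r _ k.+1) ?nnegrE ?mulr_ge0 //.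
have qq0 : 0 <= (q ^+ (k * k * b)) ^+ k.+1 :> R by rewrite exprn_ge0 // ltW.
rewrite exprMn. apply: le_trans (ler_wpM2r qq0 (I_base xi e an bn)) _.
rewrite -mulrA [leRHS]exprS; apply: ler_pM => //.
- by rewrite mulr_ge0 ?exprn_ge0.
- by apply: J_le; rewrite leq_subr.
have -> : (q ^+ (k * k * b)) ^+ k.+1 = (q ^+ (k.+1 * k * b)) ^+ k.
  by rewrite -!exprM; congr (q ^+ _); clear; lia.
rewrite -exprMn; apply: lerXn2r; rewrite ?nnegrE ?mulr_ge0 //.
apply: le_trans _ (J_sub bn); rewrite ler_wpM2l // /w exprMn.
apply: (@le_trans _ _ (1 * q ^+ (k.+1 * k * b))); first by rewrite mul1r.
apply: ler_pM => //; rewrite -exprM ler_weXn2l //.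
by move: binE; clear; nia.
Qed.

(** Transfers a saving q^s 2^t at the next level to a saving q^x 2^y here. The record property adds
    w^(b(k-1)); the two numerical hypotheses balance powers of [q] and of 2. The [k]-th root reduces
    C^k to [C]. *)
Lemma I'_bound a b xi ze (s t x y : nat) :
  (a < b)%N -> (b < n)%N -> adm a xi -> adm b ze ->
  (forall e, I b (k * b) ze e * (q ^+ s * 2 ^+ t) <= C ^+ k * J n) ->
  (k * x + k * ('C(k, 2) * (a + b) + k * (k * b - a.+1)) <=
     3 * 'C(k.+1, 2) * b * k.-1 + s)%N ->
  (k * y <= t + b * k.-1)%N ->
  I' a b xi ze * (q ^+ x * 2 ^+ y) <= C * J n.
Proof.
move=> ab bn axi aze H hx hy.
have st0 : 0 < q ^+ s * 2 ^+ t by rewrite mulr_gt0.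
pose V := C ^+ k * J n / (q ^+ s * 2 ^+ t).
have C0 : 0 <= C by apply: le_trans C1.
have V0 : 0 <= V by rewrite divr_ge0 ?mulr_ge0 ?exprn_ge0 // ltW.
have HV e : I b (k * b) ze e <= V by rewrite /V ler_pdivlMr.
have := I_congruencing ab bn axi aze V0 HV; set E := (_ + _)%N => EC.
have k0 : (0 < k)%N := ltnW (ltnW k3).
have kk : k = k.-1.+1 by rewrite prednK.
rewrite -(ler_pXn2r k0) ?nnegrE ?mulr_ge0 //.
pose u := w ^+ (b * k.-1); have u0 : 0 < u by rewrite exprn_gt0.
have Ju : J (n - b.+1)%N ^+ k.-1 * u <= J n ^+ k.-1.
  rewrite /u exprM -exprMn; apply: lerXn2r; rewrite ?nnegrE ?mulr_ge0 ?exprn_ge0 ?(ltW w0) ?(ltW Jn_gt0) //.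
  apply: le_trans _ (J_sub bn); rewrite ler_wpM2l // ler_weXn2l //.
have key : (q ^+ x * 2 ^+ y) ^+ k * (q ^+ E) ^+ k <= u * (q ^+ s * 2 ^+ t).
  rewrite /u exprM /w exprMn exprMn -!exprM.
  have -> : q ^+ (x * k) * 2 ^+ (y * k) * q ^+ (E * k) = q ^+ (k * x + k * E) * 2 ^+ (k * y).
    by rewrite exprD mulrAC [(x * k)%N]mulnC [(y * k)%N]mulnC [(E * k)%N]mulnC.
  have -> : (2 ^+ b * q ^+ (3 * 'C(k.+1, 2) * b)) ^+ k.-1 * (q ^+ s * 2 ^+ t) =
     q ^+ (3 * 'C(k.+1, 2) * b * k.-1 + s) * 2 ^+ (t + b * k.-1) :> R.
    by rewrite exprMn -!exprM !exprD; ring.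
  by apply: ler_pM => //; rewrite ler_weXn2l //; lra.
rewrite exprMn -(ler_pM2r (mulr_gt0 u0 st0)).
apply: (@le_trans _ _ ((q ^+ E) ^+ k * (V * J (n - b.+1)%N ^+ k.-1) * (q ^+ x * 2 ^+ y) ^+ k * (u * (q ^+ s * 2 ^+ t)))).
  rewrite ler_wpM2r ?ler_wpM2r // ?exprn_ge0 ?mulr_ge0 // ltW //; exact: mulr_gt0.
have -> : (q ^+ E) ^+ k * (V * J (n - b.+1)%N ^+ k.-1) * (q ^+ x * 2 ^+ y) ^+ k * (u * (q ^+ s * 2 ^+ t)) =
   ((q ^+ x * 2 ^+ y) ^+ k * (q ^+ E) ^+ k) * ((C ^+ k * J n) * (J (n - b.+1)%N ^+ k.-1 * u)).
  by rewrite /V; field; rewrite gt_eqF // gt_eqF.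
rewrite mulrC; apply: ler_pM => //.
- by rewrite !mulr_ge0 ?exprn_ge0 // ltW.
- by rewrite mulr_ge0 ?exprn_ge0 ?mulr_ge0 ?exprn_ge0 // ltW.
rewrite -mulrA (exprMn k C (J n)) ler_wpM2l ?exprn_ge0 // [in leRHS]kk exprS.
by rewrite ler_wpM2l.
Qed.

(* As long as the classes modulo [p ^ b] stay narrow, raising [b] costs [A * q],
   which is beaten by the factor [q ^ 3] assumed for each step. *)
Lemma I_descent a b0 H xi (W : R) : 0 <= W ->
  (forall h ze, (h < H)%N -> adm (b0 + h) ze -> I' a (b0 + h) xi ze * q ^+ (3 * h) <= W) ->
  (forall e, I a (b0 + H) xi e * q ^+ (3 * H) <= C * W) ->
  forall e, I a b0 xi e <= C * W.
Proof.
move=> W0 h1 h2.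
suff step h : (h <= H)%N -> forall e, I a (b0 + (H - h)) xi e * q ^+ (3 * (H - h)) <= C * W.
  by move=> e; have := step H (leqnn H) e; rewrite subnn addn0 muln0 expr0 mulr1.
elim: h => [|h IH] hH e; first by rewrite subn0.
set d := (H - h.+1)%N; have dE : (H - h = d.+1)%N by rewrite /d subnSK.
have {IH} := IH (ltnW hH); rewrite dE addnS => IH.
have C0 : 0 <= C by apply: le_trans C1.
have /(_ (C * W / q ^+ (3 * d.+1)) (W / q ^+ (3 * d))) := @I_broad_narrow a (b0 + d) xi e.
have r0 : 0 <= W / q ^+ (3 * d) by rewrite divr_ge0 // ltW.
move=> /(_ r0) bn.
rewrite -ler_pdivlMr //; apply: le_trans (bn _ _) _.
- by move=> e'; rewrite ler_pdivlMr.
- by move=> ze aze; rewrite ler_pdivlMr // h1 // /d ltn_subrL (leq_ltn_trans _ hH).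
(* Half of [C] pays for the broad term; the other half absorbs the narrow one, since A <= q and q >=
   2 give A q <= q^3 / 2. *)
have -> : C * W / q ^+ (3 * d) = C / 2 * (W / q ^+ (3 * d)) + B * q ^+ k * (W / q ^+ (3 * d)).
  by rewrite /C; field; rewrite gt_eqF.
rewrite lerD2r mulnS exprD.
have -> : A * q * (C * W / (q ^+ 3 * q ^+ (3 * d))) = (A * q / q ^+ 3) * (C * (W / q ^+ (3 * d))).
  by field; rewrite !gt_eqF.
have -> : C / 2 * (W / q ^+ (3 * d)) = 2^-1 * (C * (W / q ^+ (3 * d))) by ring.
rewrite ler_wpM2r ?mulr_ge0 ?invr_ge0 // ler_pdivrMr //.
have -> : 2^-1 * q ^+ 3 = (2^-1 * q) * (q * q) by ring.
apply: le_trans (_ : q * q <= _); first by rewrite ler_wpM2r.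
by rewrite -[leLHS]mul1r ler_wpM2r ?mulr_ge0 // ler_pdivlMl // mulr1.
Qed.

(** Induction on the number of comparisons, each adding 2^a to the trivial saving. The cap on 2^i
    keeps the target within reach of the trivial bound that ends each descent. *)
Lemma I_iterate i : 2 ^+ i <= q ^+ (4 * (k * k * k)) ->
  forall a xi e, (0 < a)%N -> ((7 * k) ^ (i + 2) * a <= n)%N -> adm a xi ->
  I a (k * a) xi e * (q ^+ (k * k * k * a) * 2 ^+ (i * a)) <= C ^+ k * J n.
Proof.
have C0 : 0 <= C by apply: le_trans C1.
elim: i => [|i IH] le_i a xi e a0 an axi.
  rewrite mul0n expr0 mulr1.
  have -> : (k * k * k * a = k * k * (k * a))%N by rewrite mulnA.
  have [an1 an2] := range_base k3 a0 an.
  apply: le_trans (I_trivial xi e an1 an2) _.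
  by rewrite -[leLHS]mul1r ler_wpM2r // exprn_ege1.
have le_i' : 2 ^+ i <= q ^+ (4 * (k * k * k)).
  by apply: le_trans _ le_i; rewrite exprS -[leLHS]mul1r ler_wpM2r // ler1n.
have [an1 an2 big] := range_step k3 a0 an.
have D0 : 0 < q ^+ (k * k * k * a) * 2 ^+ (i.+1 * a) by rewrite mulr_gt0.
pose W := C * J n / (q ^+ (k * k * k * a) * 2 ^+ (i.+1 * a)).
have W0 : 0 <= W by rewrite divr_ge0 ?mulr_ge0 // ltW.
have : I a (k * a) xi e <= C * W.
  apply: (@I_descent a (k * a) (6 * (k * a))) => // [h ze hH aze|{}e].
    rewrite /W ler_pdivlMr //.
    have -> : I' a (k * a + h) xi ze * q ^+ (3 * h) * (q ^+ (k * k * k * a) * 2 ^+ (i.+1 * a)) =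
       I' a (k * a + h) xi ze * (q ^+ (3 * h + k * k * k * a) * 2 ^+ (i.+1 * a)).
      by rewrite exprD; ring.
    have [r1 r2 r3 r4 r5] := range_class i k3 a0 hH.
    have ltn : (k * a + h < n)%N := ltn_trans r2 an2.
    apply: (@I'_bound _ _ _ _ (k * k * k * (k * a + h)) (i * (k * a + h))) => //.
      move=> e'; apply: IH => //; apply: leq_trans big; rewrite leq_mul2l.
      by rewrite ltnW ?orbT.
    exact: exponent_budget.
  rewrite -(ler_pM2r D0).
  have -> : C * W * (q ^+ (k * k * k * a) * 2 ^+ (i.+1 * a)) = C ^+ 2 * J n.
    by rewrite /W; field; rewrite !gt_eqF.
  have triv := I_trivial xi e an1 (ltnW an2).
  apply: (@le_trans _ _ (I a (k * a + 6 * (k * a)) xi e * q ^+ (k * k * (k * a + 6 * (k * a))))).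
    rewrite -!mulrA ler_wpM2l //.
    apply: (@le_trans _ _ (q ^+ (3 * (6 * (k * a))) * (q ^+ (k * k * k * a) * q ^+ (4 * (k * k * k) * a)))).
      by rewrite !ler_wpM2l // exprM [in leRHS]exprM lerXn2r // nnegrE.
    rewrite -!exprD ler_weXn2l //; exact: range_exponent.
  apply: le_trans triv _; rewrite -[leLHS]mul1r ler_wpM2r // exprn_ege1 //.
rewrite -(ler_pM2r D0) => le1; apply: le_trans le1 _.
have -> : C * W * (q ^+ (k * k * k * a) * 2 ^+ (i.+1 * a)) = C ^+ 2 * J n.
  by rewrite /W; field; rewrite !gt_eqF.
by rewrite ler_wpM2r // ler_weXn2l // ltnW.
Qed.

Variable B' : R.
Hypotheses (A'0 : 0 <= A' :> R) (A'q : A' <= q ^+ 2) (B'0 : 0 <= B' :> R).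
Hypothesis I_start : forall m (V : R), (0 < n)%N -> 0 <= V ->
  (forall ze e, adm 0 ze -> I 0 m.+1 ze e <= V) ->
  J n <= A' * q * J (n - 1)%N + B' * q ^+ k * (k%:R * (q ^+ (2 * m * (k * k) + m) * V)).

(** As 2^i is at least q^(2k^3), the iteration saves q^(3k^3 a). One comparison from level 0 turns
    this into q^(3k^2 b) for [I 0 b]. [I_start] with m = b - 1 leaves q^(-b), which beats its
    constant, while its narrow term is at most half of [J n]. *)
Lemma not_record i b : (0 < b)%N ->
  2 ^+ i <= q ^+ (4 * (k * k * k)) -> q ^+ (2 * (k * k * k)) <= 2 ^+ i ->
  2 * (B' * q ^+ k * k%:R * C ^+ 2) < q ^+ b ->
  ((7 * k) ^ (i + 2) * (4 * b) <= n)%N -> False.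
Proof.
move=> b0 i1 i2 qb nb.
have C0 : 0 <= C by apply: le_trans C1.
have [n1 n2] := range_final k3 b0 nb.
have claim a xi e : (0 < a)%N -> (a <= 4 * b)%N -> adm a xi ->
    I a (k * a) xi e * q ^+ (3 * (k * k * k) * a) <= C ^+ k * J n.
  move=> a0 ab axi.
  have an : ((7 * k) ^ (i + 2) * a <= n)%N by apply: leq_trans nb; rewrite leq_mul2l ab orbT.
  apply: le_trans _ (I_iterate i1 e a0 an axi); rewrite ler_wpM2l //.
  have -> : (3 * (k * k * k) * a = k * k * k * a + 2 * (k * k * k) * a)%N.
    by clear; lia.
  rewrite exprD ler_wpM2l // exprM [in leRHS]exprM lerXn2r ?nnegrE //.
have E0 : 0 < q ^+ (3 * (k * k) * b) by [].
pose W := C * J n / q ^+ (3 * (k * k) * b).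
have W0 : 0 <= W by rewrite divr_ge0 ?mulr_ge0.
have IW ze e : adm 0 ze -> I 0 b ze e <= C * W.
  move=> aze; apply: (@I_descent 0 b (3 * b)) => // [h ze' hH aze'|{}e].
    rewrite /W ler_pdivlMr // -mulrA -exprD.
    have [r1 r2 r3 r4] := range_class0 k3 b0 hH.
    have := @I'_bound 0 (b + h) ze ze' (3 * (k * k * k) * (b + h)) 0 (3 * h + 3 * (k * k) * b) 0.
    rewrite !expr0 !mulr1; apply => //.
    - exact: leq_ltn_trans r2 n2.
    - by move=> e'; apply: claim.
    - exact: exponent_budget0.
    - by rewrite muln0.
  rewrite -(ler_pM2r E0) -mulrA -exprD.
  have -> : C * W * q ^+ (3 * (k * k) * b) = C ^+ 2 * J n by rewrite /W; field; rewrite gt_eqF.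
  apply: (@le_trans _ _ (I 0 (b + 3 * b) ze e * q ^+ (k * k * (b + 3 * b)))).
    by rewrite ler_wpM2l // ler_weXn2l // range_exponent0.
  apply: le_trans (I_trivial _ _ _ _) _ => //; first exact: ltnW n2.
  by rewrite -[leLHS]mul1r ler_wpM2r // exprn_ege1.
have := @I_start b.-1 (C * W) n1 (mulr_ge0 C0 W0); rewrite prednK // => /(_ IW).
apply/negP; rewrite -ltNge.
have h1 : A' * q * J (n - 1)%N <= 2^-1 * J n.
  have := J_sub n1; rewrite expr1 => Jw.
  rewrite ler_pdivlMl // ; apply: le_trans _ Jw; rewrite mulrA [leRHS]mulrC ler_wpM2r //.
  rewrite /w ler_wpM2l //.
  apply: (@le_trans _ _ (q ^+ 2 * q)); first by rewrite ler_wpM2r.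
  by rewrite -exprSr ler_weXn2l // leq_pmulr // bin_gt0 ltnS (ltnW (ltnW k3)).
have h2 : B' * q ^+ k * (k%:R * (q ^+ (2 * b.-1 * (k * k) + b.-1) * (C * W))) < 2^-1 * J n.
  have -> : B' * q ^+ k * (k%:R * (q ^+ (2 * b.-1 * (k * k) + b.-1) * (C * W))) =
     (B' * q ^+ k * k%:R * C ^+ 2) * (J n * (q ^+ (2 * b.-1 * (k * k) + b.-1) / q ^+ (3 * (k * k) * b))).
    by rewrite /W; ring.
  apply: (@le_lt_trans _ _ ((B' * q ^+ k * k%:R * C ^+ 2) * (J n * (q ^+ b)^-1))).
    rewrite ler_wpM2l ?mulr_ge0 ?exprn_ge0 // ler_wpM2l //.
    rewrite ler_pdivrMr // mulrC ler_pdivlMr // -exprD ler_weXn2l //.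
    exact: range_exponent1.
  rewrite mulrCA mulrC ltr_pM2r // ltr_pdivrMr // ltr_pdivlMl //.
have -> : J n = 2^-1 * J n + 2^-1 * J n by field.
exact: ler_ltD.
Qed.
End Iteration.

(** * Bounds for Vinogradov's mean value *)

Lemma vino_gt0 k t X : (0 < X)%N -> (0 < vino k t X)%N.
Proof.
move=> X0; apply/card_gt0P; pose x : {ffun 'I_t -> 'I_X} := [ffun=> Ordinal X0].
by exists (x, x); rewrite inE; apply/forallP.
Qed.

(** Since large [n] are not records, some smaller [m] satisfies J n <= J m w^(n-m); strong induction
    descends to n < n0. The size of [p] bounds both narrow constants. *)
Lemma vino_growth k p : (3 <= k)%N -> prime p -> (k ^ (2 * (k * k)) <= p)%N ->
  exists C : nat, forall n,
    (vino k (k * k.+1) (p ^ n) <= C * (2 * p ^ (3 * 'C(k.+1, 2))) ^ n)%N.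
Proof.
move=> k3 p_pr kp; pose w := (2 * p ^ (3 * 'C(k.+1, 2)))%N.
pose J n := vino k (k * k.+1) (p ^ n).
have k0 : (0 < k)%N by lia.
have p0 := prime_gt0 p_pr; have p1 := prime_gt1 p_pr.
have kltp : (k < p)%N.
  apply: leq_trans kp; rewrite -[X in (X < _)%N]expn1 ltn_exp2l; nia.
(* 2^t lies between p and p^2, so the [i] below puts 2^i between p^(2k^3) and p^(4k^3). *)
pose t := up_log 2 p.
have t1 : (p <= 2 ^ t)%N by apply: up_logP.
have t2 : (2 ^ t <= p ^ 2)%N.
  have /andP[] := up_log_bounds (isT : (1 < 2)%N) p1; rewrite -/t => tp _.
  have t0 : (0 < t)%N by rewrite up_log_gt0.
  by rewrite -(prednK t0) expnS; nia.
pose i := (2 * (k * k * k) * t)%N.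
(* The constant that [not_record] must beat; it serves as [b] itself because M < p^M. *)
pose M := (2 * (p ^ (4 * (k * k.+1)) * p ^ k * k * (2 * p ^ (4 * (k * k)) * p ^ k) ^ 2))%N.
have M0 : (0 < M)%N by rewrite /M !(muln_gt0, expn_gt0) p0 k0.
pose n0 := ((7 * k) ^ (i + 2) * (4 * M))%N.
have nrec n : (n0 <= n)%N -> exists2 m, (m < n)%N & (J n <= J m * w ^ (n - m))%N.
  move=> n0n.
  case: (boolP [exists m : 'I_n, (J n < J m * w ^ (n - m))%N]) => [/existsP[m Jm]|].
    by exists m => //; apply: ltnW.
  rewrite negb_exists => /forallP hJ; exfalso.
  have rec m : (m <= n)%N -> (J m * w ^ (n - m) <= J n)%N.
    rewrite leq_eqVlt => /orP[/eqP ->|mn]; first by rewrite subnn muln1.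
    by have := hJ (Ordinal mn); rewrite -leqNgt.
  pose N := (k * k.+1 * (p ^ n) ^ k).+1.
  have [z prim_z] := C_prim_root_exists (isT : (0 < N)%N).
  have N_big : (k * k.+1 * (p ^ n) ^ k < N)%N by [].
  have q2 : 2 <= p%:R :> algR by rewrite (ler_nat _ 2 p).
  have := @not_record algR k n p%:R (narrow_cst k k) (broad_cst p k k) (narrow_cst k k.+1)
     (fun m => (J m)%:R) (@adm p k) (@mixed p k n N z) (@cond_mixed p k n N z) k3 q2.
  have nat_le (u v : nat) (uv : (u <= v)%N) : u%:R <= v%:R :> algR by rewrite ler_nat.
  have narrow1 : narrow_cst k k <= p%:R by rewrite /narrow_cst -natrX nat_le.
  have narrow2 : narrow_cst k k.+1 <= p%:R ^+ 2.
    rewrite /narrow_cst -!natrX nat_le //.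
    apply: leq_trans (_ : (k ^ (2 * (k * k))) ^ 2 <= _)%N; last by rewrite leq_exp2r.
    by rewrite -expnM leq_exp2l; nia.
  have broad1 u : 1 <= broad_cst p k u by rewrite exprn_ege1 // ler1n.
  have Jn0 : 0 < (J n)%:R :> algR by rewrite ltr0n vino_gt0 // expn_gt0 p0.
  have recR m : (m <= n)%N ->
      (J m)%:R * (2 * p%:R ^+ (3 * 'C(k.+1, 2))) ^+ (n - m) <= (J n)%:R :> algR.
    by move=> mn; rewrite -natrX -natrM -natrX -natrM nat_le // rec.
  move=> /(_ narrow1 (broad1 k) (fun m => ler0n _ _) Jn0 (@mixed_ge0 p k n N z) (@cond_mixed_ge0 p k n N z)).
  move=> /(_ (@mixed_base p k n N z p_pr kltp k0 N_big prim_z)).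
  move=> /(_ (@mixed_broad_narrow p k n N z p_pr k0)).
  move=> /(_ (@efficient_congruencing p k n N z p_pr kltp k0 N_big prim_z) recR).
  move=> /(_ (broad_cst p k k.+1) narrow2 (le_trans ler01 (broad1 k.+1))).
  move=> /(_ (@vino_start p k n N z p_pr k0 N_big prim_z) i M M0).
  apply => //.
  - rewrite -!natrX nat_le // /i mulnC expnM -(mulnA 2 2 (k * k * k)%N) (expnM p 2).
    by rewrite leq_exp2r // !muln_gt0 k0.
  - rewrite -!natrX nat_le // /i [X in (_ <= 2 ^ X)%N]mulnC (expnM 2).
    by rewrite leq_exp2r // !muln_gt0 k0.
  rewrite /broad_cst -!natrX -!natrM -natrX -!natrM ltr_nat.
  exact: ltn_expl.
exists (\sum_(m < n0) J m)%N.
elim/ltn_ind => n IH; have [nn0|nn0] := leqP n0 n.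
  have [m mn Jm] := nrec n nn0; apply: leq_trans Jm _.
  apply: leq_trans (leq_mul (IH m mn) (leqnn _)) _.
  by rewrite -mulnA -expnD subnKC // ltnW.
rewrite (bigD1 (Ordinal nn0)) //= -[leqLHS]muln1.
apply: leq_mul; first exact: leq_addr.
by rewrite expn_gt0 muln_gt0 expn_gt0 p0.
Qed.

(** By Newton over the rationals every [y i] is some [x j], so a solution is coded by [x] and a map
    of indices. *)
Lemma vino_diag k X : (vino k k X <= k ^ k * X ^ k)%N.
Proof.
have [->|k0] := posnP k.
  rewrite !expn0 muln1; apply: leq_trans (max_card _) _.
  by rewrite card_prod !card_ffun !card_ord !expn0.
have key (xy : {ffun 'I_k -> 'I_X} * {ffun 'I_k -> 'I_X}) i : xy \in vino_set k k X ->
    exists j, xy.2 i == xy.1 j.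
  rewrite inE => /forallP H.
  have uk j : (1 <= j <= k)%N -> (j%:R : rat) \is a GRing.unit.
    by case/andP=> j1 _; rewrite unitfE pnatr_eq0 -lt0n.
  have E (u : {ffun 'I_k -> 'I_X}) j : \sum_i ((u i : nat)%:R : rat) ^+ j = (\sum_i u i ^ j)%N%:R.
    by rewrite natr_sum; apply: eq_bigr => i' _; rewrite natrX.
  have := @power_sums_prod rat k (fun i => (xy.1 i : nat)%:R) (fun i => (xy.2 i : nat)%:R) uk.
  have hyp j : (1 <= j <= k)%N -> \sum_i ((xy.1 i : nat)%:R : rat) ^+ j = \sum_i ((xy.2 i : nat)%:R : rat) ^+ j.
    by case: j => // j jk; rewrite !E (eqP (H (Ordinal jk))).
  move=> /(_ hyp (xy.2 i : nat)%:R) /eqP; rewrite [X in _ == X](bigD1 i) //= subrr mul0r.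
  move=> /prodf_eq0[j _]; rewrite subr_eq0 eqr_nat => e; exists j.
  by rewrite -val_eqE.
pose h (xy : {ffun 'I_k -> 'I_X} * {ffun 'I_k -> 'I_X}) : {ffun 'I_k -> 'I_k} * {ffun 'I_k -> 'I_X} :=
  ([ffun i => odflt i [pick j | xy.2 i == xy.1 j]], xy.1).
have hP xy i : xy \in vino_set k k X -> xy.2 i = xy.1 ((h xy).1 i).
  move=> xyV; rewrite ffunE; case: pickP => [j /eqP //|no].
  by have [j] := key _ i xyV; rewrite no.
rewrite /vino -(@card_in_imset _ _ h); last first.
  move=> xy xy' xyV xyV' e; case: xy e xyV => x y e xyV; case: xy' e xyV' => x' y' e xyV'.
  have ex : x = x' by case: e.
  congr (_, _) => //; apply/ffunP => i.
  by have := hP _ i xyV; have := hP _ i xyV'; rewrite e /= => -> ->; rewrite ex.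
by apply: leq_trans (max_card _) _; rewrite card_prod !card_ffun !card_ord.
Qed.

(** Hölder with weights 2k+2 and k^2-2k-2, which add up to k^2; the exponents match as k(2k+2) +
    k(k+1)(k^2-2k-2) = k^2(k^2-k-2). *)
Lemma vino_interp k p n : (3 <= k)%N -> prime p -> (k < p)%N ->
  (vino k (k * k - k - 2) (p ^ n) ^ (k * k) <=
   vino k k (p ^ n) ^ (2 * k + 2) * vino k (k * k.+1) (p ^ n) ^ (k * k - 2 * k - 2))%N.
Proof.
move=> k3 p_pr kp; have k0 : (0 < k)%N by lia.
pose N := (k * k.+1 * (p ^ n) ^ k).+1.
have [z prim_z] := C_prim_root_exists (isT : (0 < N)%N).
have N_big : (k * k.+1 * (p ^ n) ^ k < N)%N by [].
have E t (tk : (t <= k * k.+1)%N) := @avg_class_sq0 p k n N z p_pr N_big prim_z t tk.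
have kk : (2 * k + 2 + (k * k - 2 * k - 2) = k * k)%N by nia.
rewrite -(ler_nat algR) natrM !natrX -!E ?leq_mul2l; try by nia.
have := @holder2 _ (2 * k + 2) (k * k - 2 * k - 2)
  (fun al => class_sq p n z 0 0 al ^+ k) (fun al => class_sq p n z 0 0 al ^+ (k * k.+1))
  (fun al => class_sq p n z 0 0 al ^+ (k * k - k - 2)).
rewrite kk; apply => [|al|al|al|al]; rewrite ?exprn_ge0 ?class_sq_ge0 //; first by nia.
by rewrite -!exprM -exprD; congr (_ ^+ _); nia.
Qed.

(** Cauchy-Schwarz over the fibres of [F], by summing 2 m_c m_d <= m_c^2 + m_d^2. *)
Lemma card_sq_le_collisions (T Z : finType) (F : T -> Z) :
  (#|T| ^ 2 <= #|[set F x | x in T]| * #|[set xy : T * T | F xy.1 == F xy.2]|)%N.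
Proof.
pose E := [set F x | x in T]; pose m c := #|[set x | F x == c]|.
have FE x : F x \in E by apply/imsetP; exists x.
have e1 : #|T| = (\sum_(c in E) m c)%N.
  rewrite -sum1_card (partition_big F (mem E)) //=; apply: eq_bigr => c _.
  by rewrite sum1dep_card.
have e2 : #|[set xy : T * T | F xy.1 == F xy.2]| = (\sum_(c in E) m c ^ 2)%N.
  rewrite -sum1_card (partition_big (fun xy => F xy.1) (mem E)) //=; apply: eq_bigr => c _.
  rewrite -mulnn -cardsX -sum1_card; apply: eq_bigl => -[x y]; rewrite !inE /=.
  by apply/andP/andP => -[/eqP e /eqP e']; split; apply/eqP; rewrite ?e // -?e' ?e.
rewrite e1 e2 -(leq_pmul2l (isT : 0 < 2)%N) -mulnn big_distrlr /=.
have -> : (2 * (#|E| * \sum_(c in E) m c ^ 2) =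
    \sum_(c in E) \sum_(d in E) (m c ^ 2 + m d ^ 2))%N.
  rewrite [RHS](eq_bigr (fun c => #|E| * m c ^ 2 + \sum_(d in E) m d ^ 2)%N); last first.
    by move=> c _; rewrite big_split /= sum_nat_const.
  by rewrite big_split /= -big_distrr /= sum_nat_const addnn mul2n.
rewrite big_distrr /=; apply: leq_sum => c _; rewrite big_distrr /=.
by apply: leq_sum => d _; rewrite (nat_Cauchy (m c) (m d)).
Qed.

(** * The lower bound and the theorem *)

Section LowerBound.
Variables (k h s X : nat).
Hypotheses (X_gt0 : (0 < X)%N) (unsolvable : ~ solvable_with k h s).

Notation T := {ffun 'I_s -> 'I_X}.

Let psum (x : T) j := (\sum_i x i ^ j)%N.

Let psum_lt x j : (psum x j < s * X ^ j + 1)%N.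
Proof.
rewrite addn1 ltnS /psum -[X in (X * _)%N](card_ord s) -sum_nat_const.
apply: leq_sum => i _; case: j => [|j]; first by rewrite !expn0.
by rewrite leq_exp2r // ltnW.
Qed.

Let Z := 'I_(s * X ^ k.+1 + 1).

Let low_vec (x : T) : {ffun 'I_k -> Z}.
Proof.
refine [ffun j : 'I_k => @Ordinal _ (psum x j.+1) _].
apply: leq_trans (psum_lt x j.+1) _; rewrite leq_add2r leq_mul2l leq_pexp2l ?orbT //.
exact: (leqW (ltn_ord j)).
Defined.

Let top (x : T) : Z := Ordinal (psum_lt x k.+1).

(** Otherwise [h] tuples from one fibre with distinct top power sums are the columns of a solution
    matrix. *)
Let few_tops (c : {ffun 'I_k -> Z}) : (#|[set top x | x in [set x | low_vec x == c]]| <= h)%N.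
Proof.
set S := [set _ | _ in _]; rewrite leqNgt; apply/negP => hS; apply: unsolvable.
have pre (b : Z) : b \in S -> exists x, (low_vec x == c) && (top x == b).
  by case/imsetP => x; rewrite inE => lx ->; exists x; rewrite lx eqxx.
pose b (u : 'I_h) : Z := enum_val (widen_ord (ltnW hS) u).
have bS u : b u \in S by apply: enum_valP.
pose x u := xchoose (pre _ (bS u)).
have xP u : low_vec (x u) = c /\ top (x u) = b u.
  by have /andP[/eqP ? /eqP ?] := xchooseP (pre _ (bS u)).
exists (\matrix_(i < s, u < h) (x u i : nat)%:Z).
have pE j u : power_sum (\matrix_(i < s, u < h) (x u i : nat)%:Z) j u = (psum (x u) j)%:Z.
  by rewrite Posz_power_sum; apply: eq_bigr => i _; rewrite mxE.
split=> [[|j] //= jk u v|u v uv].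
  rewrite !pE; congr Posz; have := congr1 (fun f : {ffun 'I_k -> Z} => val (f (Ordinal jk))) (etrans (xP u).1 (esym (xP v).1)).
  by rewrite !ffunE.
rewrite !pE => -[] e; move: uv; suff -> : u = v by rewrite ltnn.
have : b u = b v by rewrite -(xP u).2 -(xP v).2; apply: val_inj.
by move/enum_val_inj/(congr1 val) => /= /val_inj.
Qed.

(** Collisions of [F] are solutions of the degree [k.+1] system. Its image has at most [h] points
    over each vector of lower power sums, and there are at most (s+1)^k X^(k(k+1)/2) such
    vectors. *)
Lemma vino_lower_bound :
  (X ^ (2 * s) <= vino k.+1 s X * (h * ((s.+1) ^ k * X ^ 'C(k.+1, 2))))%N.
Proof.
pose F x := (low_vec x, top x).
have := card_sq_le_collisions F; rewrite card_ffun !card_ord -expnM => le1.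
rewrite (mulnC 2 s); apply: leq_trans le1 _; rewrite mulnC; apply: leq_mul.
  apply/subset_leq_card/subsetP => -[x y]; rewrite !inE /= => /eqP[e1 e2].
  apply/forallP => j; have [jk|jk] := ltnP j k.
    have := congr1 (fun f : {ffun 'I_k -> Z} => val (f (Ordinal jk))) e1.
    by rewrite !ffunE /= => e; apply/eqP.
  have -> : (j = k :> nat) by apply/eqP; rewrite eqn_leq jk -ltnS ltn_ord.
  by apply/eqP; move: e2.
apply: leq_trans (_ : #|[set low_vec x | x in T]| * h <= _)%N.
  rewrite -sum_nat_const -sum1_card (partition_big fst (mem [set low_vec x | x in T])) /=; last first.
    by move=> _ /imsetP[x _ ->]; apply/imsetP; exists x.
  apply: leq_sum => c _; apply: leq_trans (few_tops c); rewrite sum1dep_card.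
  have <- : #|[set (c, b) | b in [set top x | x in [set x | low_vec x == c]]]| =
      #|[set top x | x in [set x | low_vec x == c]]| by rewrite card_imset // => b b' [].
  apply/subset_leq_card/subsetP => -[c' b]; rewrite !inE => /andP[/imsetP[x _ [-> ->]] /eqP <-].
  by apply/imsetP; exists (top x) => //; apply/imsetP; exists x; rewrite ?inE.
rewrite mulnC leq_mul2l; apply/orP; right.
pose G (j : 'I_k) := [pred b : Z | (b < s * X ^ j.+1 + 1)%N].
apply: (@leq_trans #|family G|).
  apply/subset_leq_card/subsetP => _ /imsetP[x _ ->]; apply/familyP => j.
  by rewrite inE ffunE; apply: psum_lt.
rewrite card_family foldrE big_map big_enum /=.
apply: (@leq_trans (\prod_(j < k) (s.+1 * X ^ j.+1))%N).
  apply: leq_prod => j _; apply: leq_trans (card_ord_ltn _ _) _.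
  by rewrite mulSn addnC leq_add2r expn_gt0 X_gt0.
rewrite big_split /= prod_nat_const card_ord -expn_sum leq_mul2l; apply/orP; right.
rewrite leq_pexp2l // -bin2_sum big_mkord big_ord_recl add0n.
by apply: leq_sum.
Qed.
End LowerBound.

Lemma leq_expn_base a b e : (a <= b)%N -> (a ^ e <= b ^ e)%N.
Proof. by case: e => // e ab; rewrite leq_exp2r. Qed.

Lemma collect_powers (A C D H S X a b c i j l : nat) :
  ((A * X ^ i) ^ a * (C * (D * X ^ j)) ^ b * (H * (S * X ^ l)) ^ c =
   (A ^ a * C ^ b * (H * S) ^ c) * D ^ b * X ^ (i * a + j * b + l * c))%N.
Proof.
rewrite !expnMn !expnD -!expnM.
move: (A ^ a)%N (X ^ (i * a))%N (C ^ b)%N (D ^ b)%N (X ^ (j * b))%N (H ^ c)%N => u1 u2 u3 u4 u5 u6.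
move: (S ^ c)%N (X ^ (l * c))%N => u7 u8.
lia.
Qed.

(** The lower bound exceeds the upper one by exactly [k] in the exponent of [X]; this surplus gives
    the contradiction. *)
Lemma exponent_gap k : (3 <= k)%N ->
  (2 * (k * k - k - 2) * (k * k) =
   k + (k * (2 * k + 2) + 3 * 'C(k.+1, 2) * (k * k - 2 * k - 2) + 'C(k, 2) * (k * k)))%N.
Proof.
move=> k3.
have [u ->] : exists u, k = u.+3 by exists (k - 3)%N; lia.
have e1 : ('C(u.+4, 2) * 2 = u.+4 * u.+3)%N by rewrite mulnC -mul_bin_diag bin1.
have e2 : ('C(u.+3, 2) * 2 = u.+3 * u.+2)%N by rewrite mulnC -mul_bin_diag bin1.
have -> : (u.+3 * u.+3 - u.+3 - 2 = u * u + 5 * u + 4)%N by lia.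
have -> : (u.+3 * u.+3 - 2 * u.+3 - 2 = u * u + 4 * u + 1)%N by lia.
set A := 'C(_, _) in e1 *; set B := 'C(_, _) in e2 *.
have h1 : (3 * A * (u * u + 4 * u + 1) * 2 = 3 * (u.+4 * u.+3) * (u * u + 4 * u + 1))%N.
  by rewrite -e1; lia.
have h2 : (B * (u.+3 * u.+3) * 2 = u.+3 * u.+2 * (u.+3 * u.+3))%N by rewrite -e2; lia.
lia.
Qed.

Lemma solvable_bound h k : (2 <= h)%N -> (2 <= k)%N -> solvable_with k h (k ^ 2 + k - 2).
Proof.
move=> hh hk; apply: NNPP => unsolv.
pose K := k.+1; pose s := (K * K - K - 2)%N.
have sE : (k ^ 2 + k - 2 = s)%N by rewrite /s /K -mulnn; lia.
rewrite sE in unsolv.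
have K3 : (3 <= K)%N by [].
pose m := (K ^ (2 * (K * K)))%N.
have [p mp p_pr] := prime_above m.
pose e := (K * K - 2 * K - 2)%N.
(* The growth bound enters with 2^n to the power [e]; this choice makes p^n larger than that by a
   further 2^n. *)
have pe : (2 ^ e.+1 <= p)%N.
  apply: leq_trans (ltnW mp); apply: (@leq_trans (2 ^ (2 * (K * K)))).
    by rewrite leq_exp2l //; rewrite /e; lia.
  by rewrite /m leq_exp2r // ltnW.
have Kp : (K < p)%N.
  apply: leq_ltn_trans mp; rewrite -[leqLHS]expn1 leq_exp2l //; lia.
have p0 := prime_gt0 p_pr.
have [C grow] := vino_growth K3 p_pr (ltnW mp).
(* Every factor independent of [n], so that [n] can be chosen after it. *)
pose c0 := ((K ^ K) ^ (2 * K + 2) * C ^ e * (h * s.+1 ^ k) ^ (K * K))%N.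
have [n n_big] : exists n, (c0 < 2 ^ n)%N by exists c0; apply: ltn_expl.
pose X := (p ^ n)%N.
have X0 : (0 < X)%N by rewrite expn_gt0 p0.
have low := vino_lower_bound X0 unsolv.
have itp := vino_interp n K3 p_pr Kp; rewrite -/X -/s -/e -/K in itp low.
have diag := vino_diag K X.
have {}grow : (vino K (K * K.+1) X <= C * (2 ^ n * X ^ (3 * 'C(K.+1, 2))))%N.
  by apply: leq_trans (grow n) _; rewrite /X expnMn (expnAC p n).
have {}itp : (vino K s X ^ (K * K) <=
   (K ^ K * X ^ K) ^ (2 * K + 2) * (C * (2 ^ n * X ^ (3 * 'C(K.+1, 2)))) ^ e)%N.
  by apply: leq_trans itp _; apply: leq_mul; apply: leq_expn_base.
have {}low : ((X ^ (2 * s)) ^ (K * K) <= (K ^ K * X ^ K) ^ (2 * K + 2) *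
    (C * (2 ^ n * X ^ (3 * 'C(K.+1, 2)))) ^ e * (h * (s.+1 ^ k * X ^ 'C(K, 2))) ^ (K * K))%N.
  apply: (@leq_trans ((vino K s X * (h * (s.+1 ^ k * X ^ 'C(K, 2)))) ^ (K * K))).
    exact: leq_expn_base.
  by rewrite expnMn leq_mul.
pose f := (K * (2 * K + 2) + 3 * 'C(K.+1, 2) * e + 'C(K, 2) * (K * K))%N.
have fE : (2 * s * (K * K) = K + f)%N by exact: exponent_gap.
have key : (X ^ K <= c0 * 2 ^ (n * e))%N.
  have Xf : (0 < X ^ f)%N by rewrite expn_gt0 X0.
  rewrite -(leq_pmul2r Xf) -expnD -fE expnM; apply: leq_trans low _.
  by rewrite collect_powers (expnM 2 n e) leqnn.
have : (2 ^ n * 2 ^ (n * e) <= c0 * 2 ^ (n * e))%N.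
  apply: leq_trans key; rewrite -expnD -mulnS mulnC expnM.
  apply: (@leq_trans X); first exact: leq_expn_base.
  by rewrite -[leqLHS]expn1 leq_pexp2l.
by rewrite leq_pmul2r ?expn_gt0 // leqNgt n_big.
Qed.

Theorem theorem1p3 (h k : nat) (hh : (2 <= h)%N) (hk : (2 <= k)%N) :
  exists w : nat, is_W k h w /\ (w <= k ^ 2 + k - 2)%N.
Proof.
have sol := solvable_bound hh hk.
have [w [sw wmin]] : exists w, solvable_with k h w /\ forall s, solvable_with k h s -> (w <= s)%N.
  (* Solvability is not decided by computation, so the least admissible number is found by classical
     descent. *)
  elim/ltn_ind: (k ^ 2 + k - 2)%N sol => n IH sol.
  have [[m mn solm]|no] := classic (exists2 m, (m < n)%N & solvable_with k h m).
    exact: IH mn solm.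
  exists n; split=> // s sols; rewrite leqNgt; apply/negP => sn.
  by apply: no; exists s.
by exists w; split; [split|apply: wmin].
Qed.
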